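(* The problem Independent Set$_\ell$ has extension complexity $2^{k}n^{O(1)}$ on $n$-vertex graphs of treewidth at most $k$. Under ETH, this problem has no extended formulation with $2^{o(k)}n^{O(1)}$ inequalities.
   Context: Independent Set$_\ell$ is the vertex subset problem consisting of all pairs $(G,X)$ where $G$ is a graph and $X$ is an independent set of size at least $\ell$ in $G$. For a graph $G$, the solution polytope $P_{\Pi}(G)$ is the convex hull of the 0/1 indicator vectors (indexed by $V_G$) of all solutions $X$ of $\Pi$ in $G$. A problem $\Pi$ has extension complexity $f(k,n)$ on $n$-vertex graphs of treewidth at most $k$ if for each such graph $G$, $P_{\Pi}(G)$ has extension complexity at most $f(k,n)$ (i.e., is a projection of a polytope defined by at most $f(k,n)$ inequalities). $\Pi$ has no extended formulation with $g(k,n)$ inequalities if no polytope $P'$ that is an extended formulation (a polytope projecting onto) $P_{\Pi}(G)$ can be defined with $g(k,n)$ inequalities or fewer. *)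

(* Defs.v *)
From HB Require Import structures.
From mathcomp Require Import all_boot all_order all_algebra.
From mathcomp Require Import all_classical all_reals all_analysis.

Set Implicit Arguments.
Unset Strict Implicit.
Unset Printing Implicit Defensive.

Import Order.TTheory GRing.Theory Num.Theory.
Import numFieldNormedType.Exports.

Local Open Scope classical_set_scope.
Local Open Scope ring_scope.

Record sgraph := SGraph {
  vertex :> finType;
  edge : rel vertex;
  edge_sym : symmetric edge;
  edge_irrefl : irreflexive edge }.

Definition is_tree (T : sgraph) : Prop :=
  [/\ (0 < #|T|)%N,
      forall s t : T, connect (@edge T) s t
    & forall c : seq T, ucycle (@edge T) c -> (size c <= 2)%N].

Record tree_decomposition (G : sgraph) := TreeDecomposition {
  td_tree : sgraph;
  td_treeP : is_tree td_tree;
  td_bag : td_tree -> {set G};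
  td_vertex : forall v : G, exists t, v \in td_bag t;
  td_edge : forall u v : G, edge u v ->
    exists t, (u \in td_bag t) && (v \in td_bag t);
  td_connected : forall (v : G) (s t : td_tree),
    v \in td_bag s -> v \in td_bag t ->
    connect [rel a b | [&& edge a b, v \in td_bag a & v \in td_bag b]] s t }.

(* The largest bag size is compared with [k.+1] so that no truncated
   subtraction occurs. *)
Definition treewidth_le (G : sgraph) (k : nat) : Prop :=
  exists D : tree_decomposition G,
    (\max_(t : td_tree D) #|td_bag t| <= k.+1)%N.

Definition vertex_subset_problem := forall G : sgraph, pred {set G}.

Definition independent (G : sgraph) (X : {set G}) : bool :=
  [forall u in X, forall v in X, ~~ edge u v].

Definition independent_set_problem (l : nat) : vertex_subset_problem :=
  fun G X => independent X && (l <= #|X|)%N.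

Section Polytopes.
Variable R : realType.

Definition convex_hull (E : lmodType R) (A : set E) : set E :=
  [set x | exists m (w : 'I_m -> R) (a : 'I_m -> E),
     [/\ forall i, 0 <= w i, \sum_i w i = 1, forall i, A (a i)
       & x = \sum_i w i *: a i]].

Definition indicator_vector (V : finType) (X : {set V}) : {ffun V -> R^o} :=
  [ffun v => (v \in X)%:R].

Definition solution_polytope (P : vertex_subset_problem) (G : sgraph) :
    set {ffun G -> R^o} :=
  convex_hull [set indicator_vector X | X in [set X : {set G} | P G X]].
Arguments solution_polytope P G : clear implicits.

Definition polyhedron m d (A : 'M[R]_(m, d)) (b : 'cV[R]_m) : set 'cV[R]_d :=
  [set y | forall i, (A *m y) i 0 <= b i 0].

Definition bounded_vectors d (Q : set 'cV[R]_d) : Prop :=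
  exists M : R, forall y, Q y -> forall i, `|y i 0| <= M.

(* The polytope [S] is the image under a linear map of a polytope defined by
   [m] inequalities (an equation counts as two inequalities). *)
Definition has_extended_formulation (E : lmodType R) (S : set E) (m : nat) :
    Prop :=
  exists d (A : 'M[R]_(m, d)) (b : 'cV[R]_m) (pi : {linear 'cV[R]_d -> E}),
    bounded_vectors (polyhedron A b) /\ pi @` polyhedron A b = S.

Definition has_extension_complexity (P : vertex_subset_problem)
    (f : nat -> nat -> R) : Prop :=
  forall (k : nat) (G : sgraph), treewidth_le G k ->
  exists m : nat, m%:R <= f k #|G| /\
    has_extended_formulation (solution_polytope P G) m.

Definition no_extended_formulation (P : vertex_subset_problem)
    (f : nat -> nat -> R) : Prop :=
  exists (k : nat) (G : sgraph), treewidth_le G k /\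
  forall m : nat, m%:R <= f k #|G| ->
    ~ has_extended_formulation (solution_polytope P G) m.

Definition polynomially_bounded (p : nat -> R) : Prop :=
  exists c : nat, (p : nat -> R^o) =O_\oo (fun n => n%:R ^+ c : R^o).

Definition sublinear (g : nat -> R) : Prop :=
  (g : nat -> R^o) =o_\oo (fun k => k%:R : R^o).

End Polytopes.
Arguments solution_polytope {R} P G _.

(* Deterministic Turing machines with one tape, infinite in both directions.
   Their tape symbols are the blank [None], the input symbols [Some (inl _)]
   and auxiliary symbols [Some (inr _)]. *)
Inductive direction := GoLeft | Stay | GoRight.

Record turing_machine (I : Type) := TuringMachine {
  tm_state : finType;
  tm_aux : finType;
  tm_start : tm_state;
  (* [inr b]: halt with answer [b] *)
  tm_step : tm_state -> option (I + tm_aux) ->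
    (tm_state * option (I + tm_aux) * direction) + bool }.

Section TuringMachineRun.
Variables (I : Type) (M : turing_machine I).
Let symbol := option (I + tm_aux M).

(* [TMConfig q l a r]: state [q], scanned symbol [a], [l] the symbols to the
   left of the head (nearest first), [r] those to its right; all the cells
   not listed are blank. *)
Record tm_config := TMConfig {
  cfg_state : tm_state M;
  cfg_left : seq symbol;
  cfg_head : symbol;
  cfg_right : seq symbol }.

Definition tm_init (w : seq I) : tm_config :=
  let t : seq symbol := [seq Some (inl x) | x <- w] in
  TMConfig (tm_start M) [::] (head None t) (behead t).

Definition tm_next (c : tm_config) : tm_config + bool :=
  let: TMConfig q l a r := c in
  match tm_step q a with
  | inr b => inr b
  | inl (q', a', GoLeft) =>
      inl (TMConfig q' (behead l) (head None l) (a' :: r))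
  | inl (q', a', Stay) => inl (TMConfig q' l a' r)
  | inl (q', a', GoRight) =>
      inl (TMConfig q' (a' :: l) (head None r) (behead r))
  end.

Fixpoint tm_run (t : nat) (c : tm_config) : option bool :=
  if t is t'.+1 then
    match tm_next c with inr b => Some b | inl c' => tm_run t' c' end
  else None.

Definition tm_answers_within (w : seq I) (t : nat) (b : bool) : Prop :=
  tm_run t (tm_init w) = Some b.

End TuringMachineRun.

Definition literal (n : nat) := (bool * 'I_n)%type.
Definition clause (n : nat) := seq (literal n).
Definition cnf (n : nat) := seq (clause n).

Definition is_3cnf n (phi : cnf n) : bool :=
  all (fun c : clause n => size c <= 3)%N phi.

Definition satisfies n (a : {ffun 'I_n -> bool}) (phi : cnf n) : bool :=
  all (has (fun x : literal n => a x.2 == x.1)) phi.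

Definition satisfiable n (phi : cnf n) : bool :=
  [exists a : {ffun 'I_n -> bool}, satisfies a phi].

(* A literal is written as its sign followed by its variable index in unary.
   Against a binary encoding this changes lengths by a factor at most [n], up
   to a constant, which is immaterial next to [2 `^ (delta * n)]. *)
Inductive cnf_symbol := SignSymbol of bool | UnarySymbol | ClauseEndSymbol.

Definition encode_literal n (x : literal n) : seq cnf_symbol :=
  SignSymbol x.1 :: nseq x.2 UnarySymbol.

Definition encode_clause n (c : clause n) : seq cnf_symbol :=
  rcons (flatten [seq encode_literal x | x <- c]) ClauseEndSymbol.

Definition encode_cnf n (phi : cnf n) : seq cnf_symbol :=
  flatten [seq encode_clause c | c <- phi].

Section ETH.
Variable R : realType.

(* Running time [O(2 ^ (delta * n) * |phi| ^ O(1))] on 3-CNF formulas [phi]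
   with [n] variables. *)
Definition solves_3SAT_in_exponent (delta : R) (M : turing_machine cnf_symbol) :
    Prop :=
  exists C c : nat, forall n (phi : cnf n), is_3cnf phi ->
  exists t : nat,
    t%:R <= C%:R * 2 `^ (delta * n%:R) * (size (encode_cnf phi)).+1%:R ^+ c /\
    tm_answers_within M (encode_cnf phi) t (satisfiable phi).

(* The Exponential Time Hypothesis of Impagliazzo and Paturi. *)
Definition ETH : Prop :=
  exists delta : R, 0 < delta /\
    ~ exists M : turing_machine cnf_symbol, solves_3SAT_in_exponent delta M.

End ETH.

(* Main.v *)
From HB Require Import structures.
Require Import Defs.
From mathcomp Require Import all_boot all_order all_algebra.
From mathcomp Require Import all_classical all_reals all_analysis.
From mathcomp Require Import zify ring lra.

Set Implicit Arguments.
Unset Strict Implicit.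
Unset Printing Implicit Defensive.

Import Order.TTheory GRing.Theory Num.Theory.

Local Open Scope ring_scope.

(* Upper bound. A dynamic program over an elimination ordering keeps, for each
   eliminated part, the states (chosen subset of the boundary bag, number of
   chosen inner vertices). The convex hull of the pairs (unit vector of the
   state, indicator vector) for a combined part is obtained from those of its
   parts by a flow variable on the transitions whose marginals agree with the
   state coordinates: as the states range over a simplex, gluing along them
   preserves integrality. Each of the O(n) steps costs 2^(k+1) O(n^2)
   inequalities.

   Lower bound. It holds unconditionally. The correlation polytope on N bits is
   a projection of a face of the independent set polytope of a graph with O(N^2)
   vertices and treewidth at most 2N+3 (plus isolated vertices, which make the
   size condition harmless). Each inequality of an extended formulation yields
   a combinatorial rectangle; together with one more rectangle they cover the
   disjoint pairs (a, b) of subsets and avoid the pairs with |a & b| = 1. By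
   Kaibel and Weltge such a rectangle contains at most 2^N of the 3^N disjoint
   pairs. *)

(** * Extended formulations of dynamic programs *)

Section ExtendedFormulations.
Local Open Scope classical_set_scope.
Variable R : realType.

(** * Convex combinations of prescribed total weight *)

Section WeightedHull.
Variable E : lmodType R.
Implicit Types (A B : set E) (c : R) (x : E).

(** For [c > 0] this is the convex hull of [A] scaled by [c]. For [c = 0] it is the origin alone,
    even if [A] is empty, so a state of weight zero requires no point. Arbitrary finite index types
    allow sums and products of index sets. *)
Definition weighted_hull A c x : Prop :=
  exists (I : finType) (w : I -> R) (a : I -> E),
    [/\ forall i, 0 <= w i, \sum_i w i = c, forall i, A (a i)
      & x = \sum_i w i *: a i].

Lemma weighted_hull_ge0 A c x : weighted_hull A c x -> 0 <= c.
Proof. by case=> I [w [a [w0 <- _ _]]]; apply: sumr_ge0. Qed.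

Lemma weighted_hull_eq0 A x : weighted_hull A 0 x -> x = 0.
Proof.
case=> I [w [a [w0 sw _ ->]]]; apply: big1 => i _.
have /eqP := sw; rewrite psumr_eq0 => [/allP/(_ i)|j _]; last exact: w0.
by rewrite mem_index_enum => /(_ isT) /eqP ->; rewrite scale0r.
Qed.

Lemma weighted_hull0 A : weighted_hull A 0 0.
Proof.
exists void, (fun=> 0), (fun=> 0); split => //; try by case.
  by rewrite big1.
by rewrite big1 // => i; case: i.
Qed.

Lemma weighted_hull_point A x : A x -> weighted_hull A 1 x.
Proof.
by move=> Ax; exists unit, (fun=> 1), (fun=> x); split => //;
  rewrite (big_pred1 tt) ?scale1r // => -[].
Qed.

Lemma weighted_hullD A c1 c2 x1 x2 :
  weighted_hull A c1 x1 -> weighted_hull A c2 x2 ->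
  weighted_hull A (c1 + c2) (x1 + x2).
Proof.
move=> [I [w [a [w0 sw Aa ->]]]] [J [v [b [v0 sv Ab ->]]]].
exists (I + J)%type, (fun k => match k with inl i => w i | inr j => v j end),
  (fun k => match k with inl i => a i | inr j => b j end); split => //.
- by case.
- by rewrite big_sumType /= sw sv.
- by case.
- by rewrite big_sumType.
Qed.

Lemma weighted_hull_sum A (T : finType) (P : pred T) (c : T -> R) (x : T -> E) :
  (forall t, P t -> weighted_hull A (c t) (x t)) ->
  weighted_hull A (\sum_(t | P t) c t) (\sum_(t | P t) x t).
Proof.
move=> H; apply: (big_ind2 (weighted_hull A)) => //.
  exact: weighted_hull0.
by move=> *; exact: weighted_hullD.
Qed.

Lemma weighted_hullZ A c x l :
  0 <= l -> weighted_hull A c x -> weighted_hull A (l * c) (l *: x).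
Proof.
move=> l0 [I [w [a [w0 <- Aa ->]]]].
exists I, (fun i => l * w i), a; split => //.
- by move=> i; rewrite mulr_ge0.
- by rewrite mulr_sumr.
- by rewrite scaler_sumr; apply: eq_bigr => i _; rewrite scalerA.
Qed.

(** The product weights [u i * v j / c] have marginals [u] and [v], so a single combination of the
    points [a i + b j + w] produces all summands. *)
Lemma weighted_hull_Minkowski A1 A2 B c x1 x2 w :
  (forall y1 y2, A1 y1 -> A2 y2 -> B (y1 + y2 + w)) ->
  weighted_hull A1 c x1 -> weighted_hull A2 c x2 ->
  weighted_hull B c (x1 + x2 + c *: w).
Proof.
move=> AB H1 H2.
have [c0|c0] := eqVneq c 0.
  move: H1 H2; rewrite c0 => /weighted_hull_eq0 -> /weighted_hull_eq0 ->.
  by rewrite scale0r !addr0; exact: weighted_hull0.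
have cge0 := weighted_hull_ge0 H1.
move: H1 H2 => [I [u [a [u0 su Aa ->]]]] [J [v [b [v0 sv Ab ->]]]].
exists (I * J)%type, (fun k => u k.1 * v k.2 / c), (fun k => a k.1 + b k.2 + w).
have E1 : \sum_(k : I * J) u k.1 * v k.2 / c = c.
  rewrite -(pair_bigA _ (fun i j => u i * v j / c)) /=.
  under eq_bigr => i _ do rewrite -mulr_suml -mulr_sumr sv mulfK //.
  by [].
split => //.
- by move=> k; rewrite divr_ge0 ?mulr_ge0.
- by move=> k; apply: AB.
under [RHS]eq_bigr => k _ do rewrite !scalerDr.
rewrite !big_split /= -scaler_suml E1; congr (_ + _ + _).
- rewrite -(pair_bigA _ (fun i j => (u i * v j / c) *: a i)) /=.
  apply: eq_bigr => i _; rewrite -scaler_suml; congr (_ *: _).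
  by rewrite -mulr_suml -mulr_sumr sv mulfK.
- rewrite -(pair_bigA _ (fun i j => (u i * v j / c) *: b j)) /=.
  rewrite exchange_big /=; apply: eq_bigr => j _; rewrite -scaler_suml.
  by congr (_ *: _); rewrite -mulr_suml -mulr_suml su mulrC mulKf.
Qed.

Lemma weighted_hull1 A x : weighted_hull A 1 x <-> convex_hull A x.
Proof.
split=> [[I [w [a [w0 sw Aa ->]]]]|[m [w [a [w0 sw Aa ->]]]]]; last first.
  by exists 'I_m, w, a.
exists #|I|, (w \o enum_val), (a \o enum_val); split=> //=.
- by rewrite -sw [RHS](reindex _ (onW_bij _ (@enum_val_bij I))).
- by rewrite [LHS](reindex _ (onW_bij _ (@enum_val_bij I))).
Qed.

End WeightedHull.

(** * Formulations with state coordinates *)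

Section StateFormulations.
Variable E : lmodType R.

(* [state_hull F u x]: the pair [(u, x)] is a convex combination of the pairs
   [(e_s, x)] with [F s x], where [e_s] is the unit vector of the state [s]. *)
Definition state_hull (S : finType) (F : S -> set E) (u : S -> R) (x : E) :=
  \sum_s u s = 1 /\
  exists z : S -> E, x = \sum_s z s /\ forall s, weighted_hull (F s) (u s) (z s).

Definition lin (J : finType) (V : lmodType R) (y : J -> R) (a : J -> V) : V :=
  \sum_j y j *: a j.

Definition feasible (I J : finType) (a : I -> J -> R^o) (b : I -> R)
  (y : J -> R) : Prop := forall i, lin y (a i) <= b i.

(** Every feasible point must map into the hull, but only the generators [(e_s, x)] must be
    attained; convexity supplies the rest. Finite types index inequalities and variables, so that
    formulations can be glued along sum types. *)
Definition state_formulation (S : finType) (F : S -> set E) (m : nat) : Prop :=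
  exists (I J : finType) (a : I -> J -> R^o) (b : I -> R)
    (pu : S -> J -> R^o) (px : J -> E),
  [/\ #|I| = m,
      exists M : R, forall y, feasible a b y -> forall j, `|y j| <= M,
      forall y, feasible a b y ->
        state_hull F (fun s => lin y (pu s)) (lin y px)
    & forall s x, F s x -> exists y, [/\ feasible a b y,
        forall s', lin y (pu s') = (s' == s)%:R & lin y px = x]].

Lemma lin_inl (J1 J2 : finType) (V : lmodType R) (y : J1 + J2 -> R) (a : J1 -> V) :
  lin y (fun j => match j with inl j1 => a j1 | inr _ => 0 end) = lin (y \o inl) a.
Proof.
by rewrite /lin big_sumType /= [X in _ + X]big1 ?addr0 // => j _; rewrite scaler0.
Qed.

Lemma lin_inr (J1 J2 : finType) (V : lmodType R) (y : J1 + J2 -> R) (a : J2 -> V) :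
  lin y (fun j => match j with inl _ => 0 | inr j2 => a j2 end) = lin (y \o inr) a.
Proof.
by rewrite /lin big_sumType /= [X in X + _]big1 ?add0r // => j _; rewrite scaler0.
Qed.

Lemma linD (J : finType) (V : lmodType R) (y : J -> R) (a a' : J -> V) :
  lin y (fun j => a j + a' j) = lin y a + lin y a'.
Proof. by rewrite /lin -big_split; apply: eq_bigr => j _; rewrite scalerDr. Qed.

Lemma linN (J : finType) (V : lmodType R) (y : J -> R) (a : J -> V) :
  lin y (fun j => - a j) = - lin y a.
Proof. by rewrite /lin -sumrN; apply: eq_bigr => j _; rewrite scalerN. Qed.

Lemma lin_delta (J : finType) (V : lmodType R) (j0 : J) (a : J -> V) :
  lin (fun j => (j == j0)%:R) a = a j0.
Proof.
rewrite /lin (bigD1 j0) //= eqxx scale1r big1 ?addr0 // => j /negPf ->.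
by rewrite scale0r.
Qed.

Lemma lin_unit (J : finType) (j0 : J) (y : J -> R) :
  lin y (fun j => (j == j0)%:R : R^o) = y j0.
Proof.
rewrite /lin (bigD1 j0) //= eqxx big1 ?addr0 => [|j /negPf ->]; first exact: mulr1.
by rewrite scaler0.
Qed.

Lemma eq_lin (J : finType) (V : lmodType R) (y y' : J -> R) (a a' : J -> V) :
  y =1 y' -> a =1 a' -> lin y a = lin y' a'.
Proof. by move=> yy aa; apply: eq_bigr => j _; rewrite yy aa. Qed.

Lemma lin_ind (J : finType) (P : pred J) (y : J -> R) :
  lin y (fun j => (P j)%:R : R^o) = \sum_(j | P j) y j.
Proof.
rewrite /lin [RHS]big_mkcond /=; apply: eq_bigr => j _.
by case: (P j); [exact: mulr1 | rewrite scaler0].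
Qed.

Lemma sum_fibers (T U : finType) (V : zmodType) (h : T -> U) (f : T -> V) :
  \sum_u \sum_(t | h t == u) f t = \sum_t f t.
Proof. by rewrite [RHS](partition_big h xpredT). Qed.

(** * Gluing two formulations by a flow on transitions *)

Section Transition.
Variables (S1 S2 S T : finType) (F1 : S1 -> set E) (F2 : S2 -> set E).
Variables (src1 : T -> S1) (src2 : T -> S2) (dst : T -> S) (w : T -> E).

Definition transition_set (s : S) : set E :=
  [set x | exists t x1 x2, [/\ dst t = s, F1 (src1 t) x1, F2 (src2 t) x2
                            & x = x1 + x2 + w t]].

(** Each [z s] is divided among the transitions leaving [s] in proportion to the flow [tau]. If
    [u s = 0], the flow out of [s] and [z s] both vanish, so the division by zero is harmless. *)
Lemma weighted_hull_split (S' : finType) (F : S' -> set E) (src : T -> S')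
    (tau : T -> R) (u : S' -> R) (z : S' -> E) :
  (forall t, 0 <= tau t) -> (forall s, u s = \sum_(t | src t == s) tau t) ->
  (forall s, weighted_hull (F s) (u s) (z s)) ->
  exists x : T -> E, \sum_s z s = \sum_t x t /\
    forall t, weighted_hull (F (src t)) (tau t) (x t).
Proof.
move=> tau0 uE zH; exists (fun t => (tau t / u (src t)) *: z (src t)); split.
  rewrite -[RHS](sum_fibers src); apply: eq_bigr => s _.
  have [u0|u0] := eqVneq (u s) 0.
    have := zH s; rewrite u0 => /weighted_hull_eq0 z0; rewrite z0 big1 // => t.
    by move=> /eqP ->; rewrite z0 scaler0.
  under eq_bigr => t /eqP -> do [].
  by rewrite -scaler_suml -mulr_suml -uE divff // scale1r.
move=> t; have u0 : 0 <= u (src t) by exact: weighted_hull_ge0 (zH _).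
have := weighted_hullZ (divr_ge0 (tau0 t) u0) (zH (src t)).
have [us|us] := eqVneq (u (src t)) 0; last by rewrite divfK.
suff -> : tau t = 0 by rewrite !mul0r.
have /eqP := uE (src t); rewrite us eq_sym psumr_eq0 => [/allP/(_ t)|? _] //.
by rewrite mem_index_enum eqxx => /(_ isT)/eqP.
Qed.

(** The new variables are a nonnegative flow on [T]; its marginals along [src1] and [src2] are
    equated with the state coordinates of the two parts, each equation costing two inequalities. For
    soundness both points are split along the flow and recombined transition by transition. *)
Lemma transition_formulation m1 m2 :
  state_formulation F1 m1 -> state_formulation F2 m2 ->
  state_formulation transition_set
    (m1 + m2 + #|T| + 2 * #|S1| + 2 * #|S2|)%N.
Proof.
move=> [I1 [J1 [a1 [b1 [pu1 [px1 [cI1 bd1 snd1 cmp1]]]]]]].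
move=> [I2 [J2 [a2 [b2 [pu2 [px2 [cI2 bd2 snd2 cmp2]]]]]]].
pose J : finType := (J1 + (J2 + T))%type.
pose I : finType := (I1 + I2 + T + (bool * S1) + (bool * S2))%type.
pose e1 V (c : J1 -> V) (V0 : V) (j : J) := match j with inl j1 => c j1 | inr _ => V0 end.
pose e2 V (c : J2 -> V) (V0 : V) (j : J) := match j with inr (inl j2) => c j2 | _ => V0 end.
pose e3 V (c : T -> V) (V0 : V) (j : J) := match j with inr (inr t) => c t | _ => V0 end.
have lin1 (V : lmodType R) y (c : J1 -> V) : lin y (e1 V c 0) = lin (y \o inl) c.
  exact: lin_inl.
have lin2 (V : lmodType R) y (c : J2 -> V) :
    lin y (e2 V c 0) = lin (y \o inr \o inl) c.
  by rewrite -lin_inl -lin_inr; apply: eq_lin => // -[|[]].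
have lin3 (V : lmodType R) y (c : T -> V) :
    lin y (e3 V c 0) = lin (y \o inr \o inr) c.
  by rewrite -lin_inr -lin_inr; apply: eq_lin => // -[|[]].
pose d1 s (j : J) : R^o := e1 R^o (pu1 s) 0 j + - e3 R^o (fun t => (src1 t == s)%:R) 0 j.
pose d2 s (j : J) : R^o := e2 R^o (pu2 s) 0 j + - e3 R^o (fun t => (src2 t == s)%:R) 0 j.
pose a (i : I) : J -> R^o := match i with
  | inl (inl (inl (inl i1))) => e1 R^o (a1 i1) 0
  | inl (inl (inl (inr i2))) => e2 R^o (a2 i2) 0
  | inl (inl (inr t)) => fun j => - e3 R^o (fun t' => (t' == t)%:R) 0 j
  | inl (inr (bb, s)) => if bb then d1 s else fun j => - d1 s j
  | inr (bb, s) => if bb then d2 s else fun j => - d2 s j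
  end.
pose b (i : I) : R := match i with
  | inl (inl (inl (inl i1))) => b1 i1
  | inl (inl (inl (inr i2))) => b2 i2
  | _ => 0
  end.
pose y1 (y : J -> R) := y \o inl.
pose y2 (y : J -> R) := y \o inr \o inl.
pose tau (y : J -> R) := y \o inr \o inr.
have d1E s y : lin y (d1 s) = lin (y1 y) (pu1 s) - \sum_(t | src1 t == s) tau y t.
  by rewrite /d1 linD linN lin1 lin3 lin_ind.
have d2E s y : lin y (d2 s) = lin (y2 y) (pu2 s) - \sum_(t | src2 t == s) tau y t.
  by rewrite /d2 linD linN lin2 lin3 lin_ind.
have feasP y : feasible a b y <->
   [/\ feasible a1 b1 (y1 y), feasible a2 b2 (y2 y), forall t, 0 <= tau y t,
      forall s, lin (y1 y) (pu1 s) = \sum_(t | src1 t == s) tau y t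
    & forall s, lin (y2 y) (pu2 s) = \sum_(t | src2 t == s) tau y t].
  split=> [fy|[f1 f2 t0 m1E m2E]].
    split.
    - by move=> i; have := fy (inl (inl (inl (inl i)))); rewrite /= lin1.
    - by move=> i; have := fy (inl (inl (inl (inr i)))); rewrite /= lin2.
    - move=> t; have := fy (inl (inl (inr t))).
      by rewrite /= linN lin3 lin_unit oppr_le0.
    - move=> s; apply/eqP; rewrite -subr_eq0 -d1E eq_le.
      have /= := fy (inl (inr (true, s))); rewrite /= => ->.
      by have := fy (inl (inr (false, s))); rewrite /= linN oppr_le0.
    - move=> s; apply/eqP; rewrite -subr_eq0 -d2E eq_le.
      have /= := fy (inr (true, s)); rewrite /= => ->.
      by have := fy (inr (false, s)); rewrite /= linN oppr_le0.
  move=> [[[[i|i]|t]|[bb s]]|[bb s]] /=.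
  - by rewrite lin1; exact: f1.
  - by rewrite lin2; exact: f2.
  - by rewrite linN lin3 lin_unit oppr_le0; exact: t0.
  - by case: bb; rewrite ?linN d1E m1E subrr ?oppr0.
  - by case: bb; rewrite ?linN d2E m2E subrr ?oppr0.
exists I, J, a, b, (fun s => e3 R^o (fun t => (dst t == s)%:R) 0),
  (fun j => e1 E px1 0 j + e2 E px2 0 j + e3 E w 0 j).
have puE y s : lin y (e3 R^o (fun t => (dst t == s)%:R) 0) =
    \sum_(t | dst t == s) tau y t by rewrite lin3 lin_ind.
have pxE y : lin y (fun j => e1 E px1 0 j + e2 E px2 0 j + e3 E w 0 j) =
    lin (y1 y) px1 + lin (y2 y) px2 + lin (tau y) w.
  by rewrite !linD lin1 lin2 lin3.
split.
- rewrite /I !card_sum !card_prod card_bool cI1 cI2; lia.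
- have [[M1 M1P] [M2 M2P]] := (bd1, bd2).
  (* A flow value is at most the total flow, which is 1 since the state coordinates sum to 1. *)
  exists (Num.max (Num.max M1 M2) 1) => y /feasP [f1 f2 t0 m1E m2E].
  move=> [j|[j|t]]; rewrite !le_max.
  + by rewrite (M1P _ f1 j).
  + by rewrite (M2P _ f2 j) orbT.
  have [su [z [_ zH]]] := snd1 _ f1.
  rewrite (ger0_norm (t0 t)); apply/orP; right.
  rewrite -su (bigD1 (src1 t)) //= m1E (bigD1 t) //= -addrA.
  rewrite lerDl addr_ge0 //; first exact: sumr_ge0.
  by apply: sumr_ge0 => s _; exact: weighted_hull_ge0 (zH s).
- move=> y /feasP [f1 f2 t0 m1E m2E].
  have [su1 [z1 [x1E zH1]]] := snd1 _ f1.
  have [su2 [z2 [x2E zH2]]] := snd2 _ f2.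
  have [x1 [s1 h1]] := weighted_hull_split t0 m1E zH1.
  have [x2 [s2 h2]] := weighted_hull_split t0 m2E zH2.
  split.
    under eq_bigr => s _ do rewrite puE.
    rewrite -[RHS]su1; under [RHS]eq_bigr => s _ do rewrite m1E.
    by rewrite !sum_fibers.
  exists (fun s => \sum_(t | dst t == s) (x1 t + x2 t + tau y t *: w t)).
  split.
    by rewrite pxE x1E x2E s1 s2 sum_fibers !big_split.
  move=> s; rewrite puE; apply: weighted_hull_sum => t /eqP ts.
  apply: weighted_hull_Minkowski (h1 t) (h2 t) => p1 p2 Fp1 Fp2.
  by exists t, p1, p2.
- move=> s x [t [x1 [x2 [ts Fx1 Fx2 ->]]]].
  have [v1 [f1 u1 p1]] := cmp1 _ _ Fx1.
  have [v2 [f2 u2 p2]] := cmp2 _ _ Fx2.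
  (* A generator is attained by the flow concentrated on the single transition [t]. *)
  pose y (j : J) : R := match j with
    inl j1 => v1 j1 | inr (inl j2) => v2 j2 | inr (inr t') => (t' == t)%:R end.
  have sumdelta (P : pred T) : \sum_(t' | P t') tau y t' = (P t)%:R.
    by rewrite -lin_ind lin_delta.
  exists y; split.
  + apply/feasP; split => //.
    * by move=> s'; rewrite sumdelta u1 eq_sym.
    * by move=> s'; rewrite sumdelta u2 eq_sym.
  + by move=> s'; rewrite puE sumdelta ts eq_sym.
  + by rewrite pxE lin_delta p1 p2.
Qed.

End Transition.

Lemma unit_formulation :
  state_formulation (fun _ : unit => [set 0 : E]) 2.
Proof.
exists bool, unit, (fun b _ => if b then 1 else -1), (fun b => if b then 1 else -1),
  (fun _ _ => 1), (fun=> 0).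
have linE (V : lmodType R) (y : unit -> R) (a : unit -> V) : lin y a = y tt *: a tt.
  by rewrite /lin (big_pred1 tt) // => -[].
have feasP (y : unit -> R) : feasible (fun b _ => (if b then 1 else -1) : R^o)
    (fun b : bool => if b then 1 else -1) y <-> y tt = 1.
  split=> [fy|y1 b]; last by rewrite linE y1; case: b; rewrite scale1r.
  have := fy true; have := fy false; rewrite !linE /GRing.scale /=.
  by rewrite mulr1 mulrN1 lerN2 => *; apply/eqP; rewrite eq_le; apply/andP.
split.
- by rewrite card_bool.
- by exists 1 => y /feasP y1 []; rewrite y1 normr1.
- move=> y /feasP y1; split.
    by rewrite (big_pred1 tt) ?linE ?y1 ?scale1r // => -[].
  exists (fun=> 0); rewrite linE scaler0 big1 //; split=> // s.
  by rewrite linE y1 scale1r; exact: weighted_hull_point.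
- move=> [] x /= ->; exists (fun=> 1); split; first exact/feasP.
    by move=> s; rewrite linE scale1r; case: s.
  by rewrite linE scaler0.
Qed.

Lemma state_formulation_eq (S : finType) (F F' : S -> set E) m :
  (forall s, F s = F' s) -> state_formulation F m -> state_formulation F' m.
Proof. by move=> FF; have -> : F' = F by apply/funext => s; rewrite FF. Qed.

(** The second part is the one-state formulation of the origin. The summand [4] pays for its two
    inequalities and its one marginal equation. *)
Lemma transition1_formulation (S1 S T : finType) (F1 : S1 -> set E)
    (F : S -> set E) (src : T -> S1) (dst : T -> S) (w : T -> E) m :
  (forall s x, F s x <->
     exists t x1, [/\ dst t = s, F1 (src t) x1 & x = x1 + w t]) ->
  state_formulation F1 m ->
  state_formulation F (m + #|T| + 2 * #|S1| + 4)%N.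
Proof.
move=> FE H1.
have := transition_formulation src (fun=> tt) dst w H1 unit_formulation.
rewrite card_unit.
have -> : (m + 2 + #|T| + 2 * #|S1| + 2 * 1 = m + #|T| + 2 * #|S1| + 4)%N by lia.
apply: state_formulation_eq => s; apply/seteqP; split=> x.
  move=> [t [x1 [x2 [ts Fx ->] ->]]]; apply/FE; exists t, x1.
  by rewrite addr0.
move=> /FE [t [x1 [ts Fx ->]]]; exists t, x1, 0; split => //.
by rewrite addr0.
Qed.

Lemma convex_polyhedron_image (m d : nat) (A : 'M[R]_(m, d)) (b : 'cV[R]_m)
    (pi : {linear 'cV[R]_d -> E}) (X : set E) :
  X `<=` pi @` polyhedron A b -> convex_hull X `<=` pi @` polyhedron A b.
Proof.
move=> XP x [n [w [a [w0 sw Xa ->]]]].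
have /choice [y yP] : forall i, exists y, polyhedron A b y /\ pi y = a i.
  by move=> i; have [y ? <-] := XP _ (Xa i); exists y.
exists (\sum_i w i *: y i); last first.
  by rewrite linear_sum; apply: eq_bigr => i _; rewrite linearZ /= (yP i).2.
move=> r; rewrite mulmx_sumr summxE -[b r 0]mul1r -sw mulr_suml.
apply: ler_sum => i _; rewrite -scalemxAr mxE.
by apply: ler_wpM2l => //; exact: (yP i).1.
Qed.

(** With a single state the state coordinate is constantly 1, so the hull is an ordinary convex
    hull; the rest is a passage from finite types to matrices. *)
Lemma state_formulation_extended (F : unit -> set E) m :
  state_formulation F m -> has_extended_formulation (convex_hull (F tt)) m.
Proof.
move=> [I [J [a [b [pu [px [cI [M bd] snd cmp]]]]]]]; subst m.
pose A : 'M[R]_(#|I|, #|J|) := \matrix_(i, j) a (enum_val i) (enum_val j).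
pose bv : 'cV[R]_#|I| := \col_i b (enum_val i).
pose f (v : 'cV[R]_#|J|) (j : J) : R := v (enum_rank j) 0.
pose pf (v : 'cV[R]_#|J|) : E := lin (f v) px.
have pf_lin : linear pf.
  move=> k u v; rewrite /pf /lin scaler_sumr -big_split /=.
  by apply: eq_bigr => j _; rewrite /f !mxE scalerDl scalerA.
pose pi : {linear 'cV[R]_#|J| -> E} :=
  HB.pack pf (GRing.isLinear.Build _ _ _ _ pf pf_lin).
have AE v i : (A *m v) i 0 = lin (f v) (a (enum_val i)).
  rewrite mxE /lin (reindex _ (onW_bij _ (@enum_val_bij J))) /=.
  by apply: eq_bigr => j _; rewrite /f mxE enum_valK mulrC.
have polyE v : polyhedron A bv v <-> feasible a b (f v).
  split=> H i; last by rewrite AE mxE; exact: H.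
  by have := H (enum_rank i); rewrite AE mxE enum_rankK.
exists #|J|, A, bv, pi; split.
  exists M => v /polyE fv i.
  by have := bd _ fv (enum_val i); rewrite /f enum_valK.
apply/seteqP; split=> [x [v /polyE fv <-]|].
  have [su [z [xE zH]]] := snd _ fv; apply/weighted_hull1.
  have := zH tt; rewrite (_ : lin _ (pu tt) = 1).
    by rewrite (_ : z tt = pi v) // -[pi v]/(lin (f v) px) xE (big_pred1 tt) // => -[].
  by rewrite -su (big_pred1 tt) // => -[].
apply: convex_polyhedron_image => x Fx.
have [y [fy _ <-]] := cmp _ _ Fx.
pose v : 'cV[R]_#|J| := \col_j y (enum_val j).
have vE : f v =1 y by move=> j; rewrite /f mxE enum_rankK.
exists v.
  by apply/polyE => i; rewrite (eq_lin vE (frefl _)); exact: fy.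
exact: (eq_lin vE (frefl _)).
Qed.

End StateFormulations.
End ExtendedFormulations.

(** * Tree decompositions and elimination *)

Definition avoid (T : sgraph) (t0 : T) : rel T :=
  [rel a b | [&& edge a b, a != t0 & b != t0]].

(** If [x] and [p] differed, a simple path between them avoiding [t0] would close through [t0] to a
    cycle of length at least 3. *)
Lemma tree_neighbors_separated (T : sgraph) (t0 x p : T) :
  is_tree T -> edge t0 x -> edge t0 p -> connect (avoid t0) x p -> x = p.
Proof.
move=> [_ _ acyc] ex ep /connectP [q0 pq0 lq0]; apply/eqP; apply/negP => /negP xp.
case/shortenP: pq0 lq0 => q pq uq _ lq0.
have := acyc (t0 :: x :: q); rewrite /ucycle /ucycleb /=.
have xt0 : x != t0 by apply/eqP => xt; move: ex; rewrite xt edge_irrefl.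
have pe : path (@edge T) x q by apply: sub_path pq => a b /and3P[].
have nt0 : t0 \notin x :: q.
  rewrite inE negb_or eq_sym xt0 /=.
  elim: q x pq {xt0 ex lq0 uq pe xp} => //= y q IH x.
  move=> /andP[/and3P[_ _ yt0] /IH H].
  by rewrite inE negb_or eq_sym yt0 H.
rewrite ex rcons_path pe -lq0 edge_sym ep /= nt0 /=.
move: uq => /= -> /(_ isT) sz.
by case: q sz lq0 {pq pe nt0} => // _ /eqP; rewrite eq_sym (negPf xp).
Qed.

(** Here [d] is the distance to the root [r], and [p] is the second node of a shortest path to
    [r]. *)
Lemma tree_depth (T : sgraph) : is_tree T ->
  exists (r : T) (d : T -> nat),
    forall t, t != r -> exists2 p, edge t p & (d p < d t)%N.
Proof.
case=> /card_gt0P [r _] con _.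
have ex t : exists n, [exists q : n.-tuple T,
    path (@edge T) t q && (last t q == r)].
  have /connectP [q pq lq] := con t r.
  exists (size q); apply/existsP; exists (in_tuple q).
  by rewrite /= pq -lq eqxx.
pose d t := ex_minn (ex t).
exists r, d => t tr; rewrite /d; case: (ex_minnP (ex t)) => n.
move=> /existsP [q /andP[pq lq]] _.
case: n q pq lq => [|n] q; first by rewrite tuple0 /= (negPf tr).
case: q => -[|p q] //= sq /andP[etp pq] lq.
exists p => //; case: ex_minnP => n' _; apply.
by apply/existsP; exists (@Tuple n _ q sq); rewrite /= pq lq.
Qed.

Section Elimination.
Variables (G : sgraph) (D : tree_decomposition G).
Notation T := (td_tree D).
Notation bag := (@td_bag G D).

(** Adjacency, loops included, in the chordal completion that turns every bag into a clique. *)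
Definition share_bag (u v : G) : bool :=
  [exists t : T, (u \in bag t) && (v \in bag t)].

Lemma share_bag_refl : reflexive share_bag.
Proof. by move=> v; have [t vt] := td_vertex D v; apply/existsP; exists t; rewrite vt. Qed.

Lemma edge_share_bag u v : edge u v -> share_bag u v.
Proof. by move=> uv; have [t tP] := td_edge D uv; apply/existsP; exists t. Qed.

(* Take [v] whose subtree has the deepest top node: a subtree that meets the
   one of [v] but misses its top node would close a cycle through it. *)
Lemma simplicial_vertex (W : {set G}) : W != finset.set0 ->
  exists v t, [/\ v \in W, v \in bag t
    & forall u, u \in W -> share_bag u v -> u \in bag t].
Proof.
move=> /finset.set0Pn [w0 w0W].
have tP := td_treeP D.
have [r [d dP]] := tree_depth tP.
have top v : exists t, v \in bag t /\ forall s, v \in bag s -> (d t <= d s)%N.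
  have [t0 vt0] := td_vertex D v.
  by case: (arg_minnP (P := fun t => v \in bag t) d vt0) => t vt tmin; exists t.
have /choice [tp tpP] := top.
case: (arg_maxnP (P := fun v => v \in W) (fun v => d (tp v)) w0W) => v vW vmax.
exists v, (tp v); have [vt vmin] := tpP v; split => // u uW /existsP [s /andP[us vs]].
set t0 := tp v in vt vmin *; apply/negP => /negP ut0.
set q := tp u; have [uq _] : u \in bag q /\ _ := tpP u.
have dq : (d q <= d t0)%N := vmax _ uW.
(* Climbing to the root strictly decreases the depth, so starting no deeper than [t0] it never
   reaches [t0]. *)
have toroot z : z != t0 -> (d z <= d t0)%N -> connect (avoid t0) z r.
  elim: (d z).+1 {-2}z (ltnSn (d z)) => // n IH {}z zn zt dz.
  have [->|zr] := eqVneq z r; first exact: connect0.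
  have [p ep dp] := dP _ zr.
  have pt : p != t0 by apply/eqP => pt; move: dp; rewrite pt ltnNge dz.
  apply: (@connect_trans _ _ p); first by apply: connect1; rewrite /avoid /= ep zt pt.
  by apply: IH => //; [exact: leq_trans dp zn | exact: leq_trans (ltnW dp) dz].
have avsym : connect_sym (avoid t0).
  by apply: sym_connect_sym => a b; rewrite /avoid /= edge_sym; congr andb; exact: andbC.
have qt0 : q != t0 by apply: contraNneq ut0 => <-.
have st0 : s != t0 by apply: contraNneq ut0 => <-.
have [t0r|t0r] := eqVneq t0 r.
  have : q != r by rewrite -t0r.
  have := toroot _ qt0 dq => /connectP [[|a l]] /=.
    by move=> _ ->; rewrite eqxx.
  move=> pa la _; have : r != t0; last by rewrite t0r eqxx.
  rewrite la; elim: l q a pa {la dq uq qt0} => /= [|c l IH] q a.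
    by case/andP => /and3P[].
  by case/andP=> _ /IH.
have [p ep dp] := dP _ t0r.
have sq : connect (avoid t0) s q.
  have := td_connected us uq; apply: connect_sub => a b /and3P[eab ua ub].
  apply: connect1; rewrite /avoid /= eab /=.
  by apply/andP; split; apply: contraNneq ut0 => <-.
(* The path inside the subtree of [v] leaves [t0] through some [x]. Avoiding [t0], [x] is joined to
   [s], then to [q] in the subtree of [u], then to the root and to the parent [p]. So [x = p], and
   [v] lies in a bag above its top node. *)
have /connectP [l0 pl0 ls0] := td_connected vt vs.
case/shortenP: pl0 ls0 => -[|x l] /=; first by move=> _ _ _ st; rewrite st eqxx in st0.
move=> /andP[/and3P[ex _ vx] pl] /andP[nt0 _] _ ls0.
have xs : connect (avoid t0) x s.
  apply/connectP; exists l => //.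
  move: nt0; rewrite inE negb_or eq_sym => /andP[xt0 nl].
  elim: l x xt0 pl nl {ls0 ex vx} => //= y l IH x xt0.
  rewrite inE negb_or => /andP[/and3P[exy vx' vy] pl] /andP[yt0 nl].
  rewrite {1}/avoid /= exy xt0 eq_sym yt0 /=; apply: IH => //; by rewrite eq_sym.
have pt0 : p != t0 by apply/eqP => pt; rewrite pt ltnn in dp.
have xp : connect (avoid t0) x p.
  apply: connect_trans xs _; apply: connect_trans sq _.
  apply: connect_trans (toroot _ qt0 dq) _; rewrite avsym.
  by apply: toroot => //; exact: ltnW.
have xpE := tree_neighbors_separated tP ex ep xp.
by have := vmin _ vx; rewrite xpE leqNgt dp.
Qed.

End Elimination.

(** * Independent sets of bounded treewidth graphs *)

Section DynamicProgram.
Import mathcomp.boot.seq mathcomp.boot.fintype mathcomp.boot.finset.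
Variables (R : realType) (G : sgraph).
Notation n := #|G|.
Notation E := {ffun G -> R^o}.
Notation ind := (indicator_vector R).
Implicit Types (A B C U X Y : {set G}).

Lemma independentP X :
  reflect (forall u v, u \in X -> v \in X -> ~~ edge u v) (independent X).
Proof.
apply: (iffP forallP) => [H u v uX vX|H u].
  by have /implyP/(_ uX)/forallP/(_ v)/implyP/(_ vX) := H u.
by apply/implyP => uX; apply/forallP => v; apply/implyP => vX; exact: H.
Qed.

Lemma independentS X Y : X \subset Y -> independent Y -> independent X.
Proof.
move=> /subsetP XY /independentP H; apply/independentP => u v /XY uY /XY.
exact: H.
Qed.

Lemma card_disjointU X Y : [disjoint X & Y] -> #|X :|: Y| = (#|X| + #|Y|)%N.
Proof. by move=> d; rewrite -cardsUI disjoint_setI0 // cards0 addn0. Qed.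

Lemma ind_disjointU X Y : [disjoint X & Y] -> ind (X :|: Y) = ind X + ind Y.
Proof.
move=> d; apply/ffunP => v; rewrite !ffunE in_setU.
have := disjointFr d (x := v); case: (v \in X) => [->|_]; rewrite ?addr0 //.
by case: (v \in Y); rewrite ?add0r ?addr0.
Qed.

Lemma ind0 : ind (set0 : {set G}) = 0.
Proof. by apply/ffunP => v; rewrite !ffunE in_set0. Qed.

Definition subs B : finType := {A : {set G} | A \subset B}.
Definition indep_subs B : finType := {A : {set G} | (A \subset B) && independent A}.
Definition states B : finType := (subs B * 'I_n.+1)%type.
Definition restr B A : subs B := exist _ (A :&: B) (subsetIr A B).

Lemma val_restr B A : val (restr B A) = A :&: B. Proof. by []. Qed.

Lemma restr_val B (A : subs B) : restr B (val A) = A.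
Proof. by apply: val_inj; rewrite val_restr; apply/setIidPl; exact: (valP A). Qed.

Lemma card_subs B : #|subs B| = (2 ^ #|B|)%N.
Proof.
by rewrite card_sig -card_powerset; apply: eq_card => A; rewrite !inE.
Qed.

Lemma card_indep_subs B : (#|indep_subs B| <= 2 ^ #|B|)%N.
Proof.
rewrite card_sig -card_powerset; apply: subset_leq_card.
by apply/subsetP => A; rewrite !inE => /andP[].
Qed.

(** Boundary vertices enter neither the count nor the vector; they are added when forgotten, so a
    vertex shared by several parts is counted once. The set is empty if the boundary choice is not
    independent. *)
Definition piece_set B U (s : states B) : set E := fun x =>
  exists X, [/\ X \subset U, independent (val s.1 :|: X), #|X| = s.2 & x = ind X].

Definition boundary U B := forall u v, u \in U -> edge u v -> v \in U :|: B.

Lemma card_ord_inord X : (inord #|X| : 'I_n.+1) = #|X| :> nat.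
Proof. by rewrite inordK // ltnS max_card. Qed.

(** A transition chooses an independent subset of [C] and one count for each part. Independence
    within [C] is checked here because [B1] and [B2] may not contain all edges of [C]. *)
Lemma join_formulation B1 U1 B2 U2 C m1 m2 :
  B1 \subset C -> B2 \subset C -> [disjoint C & U1] -> [disjoint C & U2] ->
  [disjoint U1 & U2] -> boundary U1 B1 -> boundary U2 B2 ->
  state_formulation (piece_set (B := B1) U1) m1 ->
  state_formulation (piece_set (B := B2) U2) m2 ->
  state_formulation (piece_set (B := C) (U1 :|: U2))
   (m1 + m2 + #|{: indep_subs C * 'I_n.+1 * 'I_n.+1}| + 2 * #|states B1| + 2 * #|states B2|)%N.
Proof.
move=> B1C B2C dC1 dC2 d12 bd1 bd2 H1 H2.
pose T : finType := (indep_subs C * 'I_n.+1 * 'I_n.+1)%type.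
pose src1 (t : T) : states B1 := (restr B1 (val t.1.1), t.1.2).
pose src2 (t : T) : states B2 := (restr B2 (val t.1.1), t.2).
(* [inord] overflows only for counts that no two disjoint sets attain together, and such transitions
   yield no points. *)
pose dst (t : T) : states C := (restr C (val t.1.1), inord (t.1.2 + t.2)).
have := transition_formulation src1 src2 dst (fun=> 0) H1 H2.
apply: state_formulation_eq => s; apply/seteqP; split => x.
  move=> [[[A j1] j2] [x1 [x2 [<- [X1 [X1U i1 c1 ->]] [X2 [X2U i2 c2 ->]] ->]]]].
  rewrite /= in i1 c1 i2 c2.
  have /andP[AC iA] := valP A.
  have dX : [disjoint X1 & X2].
    exact: disjointWl X1U (disjointWr X2U d12).
  have crd := card_disjointU dX.
  exists (X1 :|: X2); split.
  - exact: setUSS.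
  - rewrite /= (setIidPl AC).
    (* An edge from [X] ends in [U] or [B], where the whole selection reduces to [X] and the part of
       [A] in [B]; these are jointly independent. *)
    have out U B X X' : boundary U B -> B \subset C -> [disjoint C & U] ->
        X \subset U -> [disjoint U & X'] -> [disjoint C & X'] ->
        independent (val A :&: B :|: X) ->
        forall u v, u \in X -> v \in val A :|: (X :|: X') -> ~~ edge u v.
      move=> bd BC dCU XU dUX dCX /independentP iX u v uX vAX.
      apply/negP => uv; have uU := subsetP XU _ uX.
      have : v \in val A :&: B :|: X; last first.
        by move=> vX; move: (iX u v); rewrite uv in_setU uX orbT vX => /(_ isT isT).
      have := bd _ _ uU uv; move: vAX; rewrite !inE => vAX vUB.
      case/orP: vAX => [vA|/orP[->|vX']]; last first.
      + case/orP: vUB => [vU|vB]; first by rewrite (disjointFr dUX vU) in vX'.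
        by rewrite (disjointFr dCX (subsetP BC _ vB)) in vX'.
      + by rewrite orbT.
      rewrite vA /=; case/orP: vUB => [vU|->//].
      by rewrite (disjointFr dCU (subsetP AC _ vA)) in vU.
    have o1 := out _ _ _ X2 bd1 B1C dC1 X1U (disjointWr X2U d12) (disjointWr X2U dC2) i1.
    have d21 : [disjoint U2 & X1] by rewrite disjoint_sym; exact: disjointWl X1U d12.
    have o2 := out _ _ _ X1 bd2 B2C dC2 X2U d21 (disjointWr X1U dC1) i2.
    rewrite setUC in o2; rewrite [X2 :|: X1]setUC in o2.
    rewrite [X1 :|: X2 :|: _]setUC in o2.
    apply/independentP => u v; rewrite in_setU => uE vE.
    case/orP: uE => [uA|]; last by rewrite in_setU => /orP[] uX; [exact: o1|exact: o2].
    move: vE; rewrite in_setU => /orP[vA|vX].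
      by move/independentP: iA; apply.
    rewrite edge_sym; have uE : u \in val A :|: (X1 :|: X2) by rewrite in_setU uA.
    by move: vX; rewrite in_setU => /orP[] vX; [exact: o1|exact: o2].
  - by rewrite /= -c1 -c2 -crd card_ord_inord.
  - by rewrite addr0 ind_disjointU.
case: s => A j [X [XU iX cX ->]]; rewrite /= in iX cX.
have XE : X = (X :&: U1) :|: (X :&: U2).
  by rewrite -setIUr; apply/esym/setIidPl.
have dX : [disjoint X :&: U1 & X :&: U2].
  exact: disjointWl (subsetIr _ _) (disjointWr (subsetIr _ _) d12).
have AP : (val A \subset C) && independent (val A).
  by rewrite (valP A); apply: independentS iX; exact: subsetUl.
pose A' : indep_subs C := Sub (val A) AP.
exists (A', inord #|X :&: U1|, inord #|X :&: U2|), (ind (X :&: U1)), (ind (X :&: U2)).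
have iS B (U : {set G}) : independent (val A :&: B :|: X :&: U).
  by apply: independentS iX; apply: setUSS; exact: subsetIl.
split.
- rewrite /dst /= restr_val !card_ord_inord -card_disjointU // -XE cX.
  by congr pair; apply: val_inj; rewrite /= inordK.
- by exists (X :&: U1); rewrite subsetIr card_ord_inord; split => //; exact: iS.
- by exists (X :&: U2); rewrite subsetIr card_ord_inord; split => //; exact: iS.
- by rewrite addr0 -ind_disjointU // -XE.
Qed.

(** Every state of [C] is its own transition: [v] leaves the boundary choice and, if chosen, is
    added to the count and to the vector. *)
Lemma forget_formulation C U v m :
  v \in C -> [disjoint C & U] ->
  state_formulation (piece_set (B := C) U) m ->
  state_formulation (piece_set (B := C :\ v) (v |: U))
    (m + #|states C| + 2 * #|states C| + 4)%N.
Proof.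
move=> vC dCU.
have vU : v \notin U by rewrite (disjointFr dCU vC).
pose dst (t : states C) : states (C :\ v) :=
  (restr (C :\ v) (val t.1), inord (t.2 + (v \in val t.1))).
apply: (transition1_formulation (src := id) (dst := dst)
         (w := fun t => ind (val t.1 :&: [set v]))) => -[A j] x.
split.
  move=> [X [XU iX cX ->]]; rewrite /= in iX cX.
  have vA : v \notin val A.
    by apply/negP => /(subsetP (valP A)); rewrite inE in_set1 eqxx.
  have AC : val A \subset C by apply: subset_trans (valP A) (subD1set _ _).
  pose A' := val A :|: X :&: [set v].
  have A'C : A' \subset C.
    rewrite subUset AC; apply: subset_trans (subsetIr _ _) _.
    by rewrite sub1set.
  have A'v : A' :&: [set v] = X :&: [set v].
    apply/setP => u; rewrite !inE; case: eqP => [->|]; rewrite ?andbF // (negPf vA).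
    by rewrite !andbT.
  have dX : [disjoint X :\ v & X :&: [set v]].
    rewrite -setI_eq0; apply/eqP/setP => u; rewrite !inE.
    by case: (u == v); rewrite ?andbF.
  have XE : X = (X :\ v) :|: X :&: [set v].
    by apply/setP => u; rewrite !inE; case: (u == v); rewrite ?andbT ?andbF ?orbF.
  exists (restr C A', inord #|X :\ v|), (ind (X :\ v)); rewrite /= (setIidPl A'C); split.
  - rewrite /dst /= (setIidPl A'C) card_ord_inord; congr pair; apply: val_inj => /=.
      apply/setP => u; rewrite !inE.
      have := subsetP (valP A) u; rewrite !inE.
      case: eqP => [->|_]; rewrite ?(negPf vA) ?andbF ?orbF //=.
      by case: (u \in val A) => // /(_ isT) ->.
    rewrite addnC (_ : (v \in A') = (v \in X)) -?cardsD1 ?cX ?inordK //.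
    by rewrite !inE eqxx (negPf vA) andbT.
  - exists (X :\ v); rewrite card_ord_inord; split => //=.
      by rewrite subDset.
    rewrite (setIidPl A'C); apply: independentS iX; apply/subsetP => u.
    rewrite !inE; case: (u \in val A) => //=; case: (u \in X); rewrite ?andbF //.
  - by rewrite A'v -ind_disjointU // -XE.
move=> [[A' j'] [x1 [/= [<- <-] [X [XU iX cX ->]] ->]]]; rewrite /= in iX cX.
have dX : [disjoint X & val A' :&: [set v]].
  apply: disjointWl XU _; rewrite -setI_eq0; apply/eqP/setP => u; rewrite !inE.
  by case: eqP => [->|]; rewrite ?andbF // (negPf vU).
exists (X :|: val A' :&: [set v]); split.
- rewrite subUset; apply/andP; split.
    by apply: subset_trans XU _; exact: subsetUr.
  by apply: subset_trans (subsetIr _ _) _; exact: subsetUl.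
- apply: independentS iX; apply/subsetP => u; rewrite !inE /=.
  by case: (u \in val A'); case: (u \in X); rewrite ?orbT ?andbF.
- rewrite /= -cX.
  have -> : (v \in val A') = #|val A' :&: [set v]| :> nat.
    case vA: (v \in val A').
      by rewrite (_ : _ :&: _ = [set v]) ?cards1 //; apply/setIidPr; rewrite sub1set.
    rewrite (_ : _ :&: _ = set0) ?cards0 //; apply/setP => u; rewrite !inE.
    by case: eqP => [->|]; rewrite ?andbF // vA.
  by rewrite -card_disjointU // card_ord_inord.
- by rewrite ind_disjointU.
Qed.

(** Each independent subset of [C] receives one transition from the trivial state, with count 0; all
    other states have no points. *)
Lemma empty_formulation C :
  state_formulation (piece_set (B := C) set0) (2 + #|indep_subs C| + 2 * 1 + 4)%N.
Proof.
rewrite -[X in (2 * X)%N]card_unit.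
apply: (transition1_formulation (src := fun=> tt) (F1 := fun=> [set 0 : E]%classic)
  (dst := fun t : indep_subs C => (restr C (val t), ord0) : states C) (w := fun=> 0)).
  move=> [A j] x; split.
    move=> [X []]; rewrite subset0 => /eqP -> iA; rewrite cards0 => j0 ->.
    have AP : (val A \subset C) && independent (val A).
      by rewrite (valP A); apply: independentS iA; exact: subsetUl.
    exists (Sub (val A) AP), 0; split => //; last by rewrite ind0 addr0.
    by rewrite /= restr_val; congr pair; exact: val_inj.
  move=> [t [x1 [[<- <-] -> ->]]]; exists set0.
  have /andP[tC it] := valP t.
  by rewrite sub0set setU0 /= (setIidPl tC) it cards0 ind0 addr0.
exact: unit_formulation.
Qed.

(** * Eliminating all vertices and counting the inequalities *)

Section Pieces.
Variable k : nat.

(** Bounds the inequalities of one empty piece, one join or one forgetting over a set of at most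
    [k.+1] vertices. *)
Definition step_cost := (5 * 2 ^ k.+1 * n.+1 ^ 2)%N.

Definition formulation_le (S : finType) (F : S -> set E) m :=
  exists2 m', (m' <= m)%N & state_formulation F m'.

Lemma card_states_le B : (#|B| <= k.+1)%N -> (#|states B| <= 2 ^ k.+1 * n.+1)%N.
Proof. by move=> Bk; rewrite card_prod card_subs card_ord leq_mul2r leq_exp2l ?Bk ?orbT. Qed.

Lemma card_indep_subs_le B : (#|B| <= k.+1)%N -> (#|indep_subs B| <= 2 ^ k.+1)%N.
Proof. by move=> Bk; apply: leq_trans (card_indep_subs B) _; rewrite leq_exp2l. Qed.

Lemma pow2k_gt1 : (2 <= 2 ^ k.+1)%N.
Proof. by rewrite -{1}(expn1 2) leq_exp2l. Qed.

Record piece := Piece {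
  piece_boundary : {set G}; piece_inner : {set G}; piece_size : nat }.

Definition piece_ok p :=
  boundary (piece_inner p) (piece_boundary p) /\
  formulation_le (piece_set (B := piece_boundary p) (piece_inner p)) (piece_size p).

Fixpoint pieces_ok (L : seq piece) (Q : piece -> Prop) : Prop :=
  if L is p :: L' then [/\ piece_ok p, Q p & pieces_ok L' Q] else True.

(** As a number it expresses coverage and disjointness of the inner sets together: adding membership
    in [W] gives 1 exactly when they partition the vertices with [W]. *)
Definition multiplicity (L : seq piece) (x : G) : nat :=
  (\sum_(p <- L) (x \in piece_inner p))%N.

Definition cost (L : seq piece) : nat := (\sum_(p <- L) (piece_size p + step_cost))%N.

(** The pieces are joined one by one to the empty piece over [C]; the multiplicity bound provides
    every disjointness that a join requires. *)
Lemma join_pieces C L : (#|C| <= k.+1)%N ->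
  pieces_ok L (fun p => piece_boundary p \subset C) ->
  (forall x, multiplicity L x + (x \in C) <= 1)%N ->
  exists U, [/\ boundary U C, forall x, (x \in U) = multiplicity L x :> nat
    & formulation_le (piece_set (B := C) U) (step_cost + cost L)].
Proof.
move=> Ck; elim: L => [_ _|p L IH /= [[bdp [mp mple fp]] pC ok] cov].
  exists set0; split.
  - by move=> u v; rewrite in_set0.
  - by move=> x; rewrite in_set0 /multiplicity big_nil.
  - eexists; last exact: empty_formulation.
    rewrite /cost big_nil addn0 /step_cost.
    have := card_indep_subs_le Ck; have := pow2k_gt1.
    have : (1 <= n.+1 ^ 2)%N by rewrite expn_gt0.
    set a := (_ ^ _)%N; set b := (_ ^ _)%N; nia.
have covE x : multiplicity (p :: L) x = ((x \in piece_inner p) + multiplicity L x)%N.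
  by rewrite /multiplicity big_cons.
have [|U [bdU UE [m mle fU]]] := IH ok.
  by move=> x; apply: leq_trans (cov x); rewrite covE leq_add2r leq_addl.
have dis (X Y : {set G}) : (forall x, (x \in X) + (x \in Y) <= 1)%N -> [disjoint X & Y].
  move=> H; rewrite -setI_eq0; apply/eqP/setP => x; rewrite !inE.
  by have := H x; case: (x \in X); case: (x \in Y).
have dCp : [disjoint C & piece_inner p].
  by apply: dis => x; have := cov x; rewrite covE; lia.
have dCU : [disjoint C & U].
  by apply: dis => x; have := cov x; rewrite covE UE; lia.
have dpU : [disjoint piece_inner p & U].
  by apply: dis => x; have := cov x; rewrite covE UE; lia.
exists (piece_inner p :|: U); split.
- move=> u v; rewrite in_setU => /orP[uU uv|uU uv].
    have := bdp _ _ uU uv; rewrite !inE => /orP[->//|/(subsetP pC) ->].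
    by rewrite orbT.
  by have := bdU _ _ uU uv; rewrite !inE -orbA => ->; rewrite orbT.
- move=> x; rewrite covE -UE in_setU; have := cov x; rewrite covE -UE.
  by case: (x \in piece_inner p); case: (x \in U).
eexists; last exact: (join_formulation pC (subxx C) dCp dCU dpU bdp bdU fp fU).
rewrite /cost big_cons -/(cost L) !card_prod !card_ord -/(states _).
have pk : (#|piece_boundary p| <= k.+1)%N.
  by apply: leq_trans Ck; exact: subset_leq_card.
have := card_indep_subs_le Ck.
have : (#|subs (piece_boundary p)| <= 2 ^ k.+1)%N by rewrite card_subs leq_exp2l.
have : (#|subs C| <= 2 ^ k.+1)%N by rewrite card_subs leq_exp2l.
rewrite {2}/step_cost.
set a := (2 ^ _)%N; move: #|subs C| #|subs (piece_boundary p)| #|indep_subs C| => c1 c2 c3 h1 h2 h3.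
have : (c3 * n.+1 * n.+1 + 2 * (c2 * n.+1) + 2 * (c1 * n.+1) <= 5 * a * n.+1 ^ 2)%N.
  move: #|G|.+1 (ltn0Sn #|G|) => N N0.
  have e3 : (c3 * N * N <= a * (N * N))%N by rewrite -mulnA leq_mul.
  have e2 : (c2 * N <= a * (N * N))%N by apply: leq_mul => //; exact: leq_pmulr.
  have e1 : (c1 * N <= a * (N * N))%N by apply: leq_mul => //; exact: leq_pmulr.
  by rewrite -mulnn; lia.
lia.
Qed.

Variable D : tree_decomposition G.
Hypothesis Dk : forall t : td_tree D, (#|td_bag t| <= k.+1)%N.

Definition clique B := forall u v, u \in B -> v \in B -> share_bag D u v.

Lemma pieces_ok_filter (L : seq piece) (a : pred piece) (Q Q' : piece -> Prop) :
  pieces_ok L Q -> (forall p, a p -> Q p -> Q' p) -> pieces_ok (filter a L) Q'.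
Proof.
move=> + QQ; elim: L => //= p L IH [okp Qp okL].
by case: ifP => [ap|_]; last exact: IH; split; [|exact: QQ|exact: IH].
Qed.

(** The last clause stands in for membership of [p] in [L]. *)
Lemma pieces_ok_mem (L : seq piece) (Q : piece -> Prop) x :
  pieces_ok L Q -> (0 < multiplicity L x)%N ->
  exists p, [/\ piece_ok p, x \in piece_inner p & forall (a : pred piece) z,
    a p -> z \in piece_inner p -> (0 < multiplicity (filter a L) z)%N].
Proof.
elim: L => [|p L IH] /=; first by rewrite /multiplicity big_nil.
move=> [okp Qp okL]; case xp: (x \in piece_inner p).
  by move=> _; exists p; split => // a z ap zp; rewrite ap /multiplicity big_cons zp.
rewrite /multiplicity big_cons xp add0n => /(IH okL) [q [okq xq H]].
exists q; split => // a z aq zq; have := H a z aq zq; case: ifP => _ //.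
by rewrite /multiplicity big_cons => ?; exact: ltn_addl.
Qed.

(** Induction on the number of remaining vertices. For a simplicial [v], all pieces with [v] on
    their boundary live over [C], the neighbours of [v] in the completion, which fit in one bag;
    they are joined and [v] is forgotten. The three steps per vertex are the empty piece, the
    forgetting, and the charge for joining the new piece later. *)
Lemma eliminate_all (W : {set G}) L :
  pieces_ok L (fun p => piece_boundary p \subset W /\ clique (piece_boundary p)) ->
  (forall x, multiplicity L x + (x \in W) = 1)%N ->
  formulation_le (piece_set (B := set0) [set: G])
    (step_cost + cost L + 3 * step_cost * #|W|).
Proof.
elim: {W}#|W| {-2}W (erefl #|W|) L => [|w IH] W cW L ok cov.
  have W0 : W = set0 by apply/eqP; rewrite -cards_eq0 cW.
  subst W; have [||x|U [_ UE [m mle fU]]] := @join_pieces set0 L.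
  - by rewrite cards0.
  - rewrite -(filter_predT L); apply: pieces_ok_filter ok _ => p _.
    by case.
  - by rewrite cov.
  have -> : [set: G] = U.
    apply/setP => x; rewrite in_setT; apply/esym.
    by have := cov x; rewrite -UE in_set0; case: (x \in U).
  by exists m => //; apply: leq_trans mle _; exact: leq_addr.
have [|v [t [vW vt vmax]]] := @simplicial_vertex G D W.
  by rewrite -cards_eq0 cW.
pose C := [set u in W | share_bag D u v].
have vC : v \in C by rewrite !inE vW share_bag_refl.
have Ct : C \subset td_bag t.
  by apply/subsetP => u; rewrite inE => /andP[uW uv]; exact: vmax.
have Ck : (#|C| <= k.+1)%N by apply: leq_trans (Dk t); exact: subset_leq_card.
have CW : C \subset W by apply/subsetP => u; rewrite inE => /andP[].
pose a (p : piece) := v \in piece_boundary p.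
have covS x : multiplicity L x =
    (multiplicity (filter a L) x + multiplicity (filter (predC a) L) x)%N.
  by rewrite /multiplicity !big_filter (bigID a).
have [||x|U [bdU UE [m mle fU]]] := @join_pieces C (filter a L).
- by [].
- apply: pieces_ok_filter ok _ => p ap [pW pc]; apply/subsetP => u up.
  by rewrite inE (subsetP pW _ up) pc.
- rewrite -(cov x) covS; have := subsetP CW x.
  by case: (x \in C) => [->//|_]; lia.
have dCU : [disjoint C & U].
  rewrite -setI_eq0; apply/eqP/setP => x; rewrite in_setI in_set0.
  apply/negP => /andP[xC xU]; have := cov x; rewrite covS -UE xU.
  by rewrite (subsetP CW _ xC); lia.
have vU : v \notin U by rewrite (disjointFr dCU vC).
have f' := forget_formulation vC dCU fU.
pose p' := Piece (C :\ v) (v |: U) (step_cost + cost (filter a L) + step_cost).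
have okp' : piece_ok p'.
  split; last first.
    eexists; last exact: f'.
    move: #|states C| (card_states_le Ck) => c ck; rewrite /=.
    suff : (3 * c + 4 <= step_cost)%N by lia.
    have := pow2k_gt1; rewrite /step_cost -mulnn.
    by move: (2 ^ k.+1)%N #|G|.+1 (ltn0Sn #|G|) ck => q N N0 ck q1; nia.
  move=> /= u x; rewrite in_setU1 => uvU ux.
  suff : x \in U :|: C.
    by rewrite !inE; case: (x == v); case: (x \in U).
  case/orP: uvU => [/eqP uv|uU]; last exact: bdU uU ux.
  rewrite {u}uv in ux; rewrite in_setU.
  (* A neighbour of [v] in [W] is in [C]. Any other neighbour is inner to some piece; as [v] is not
     inner to it, [v] is on its boundary, so that piece was joined into [U]. *)
  case xW: (x \in W).
    by rewrite [x \in C]inE xW edge_share_bag ?orbT // edge_sym.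
  have : (0 < multiplicity L x)%N by have := cov x; rewrite xW addn0 => ->.
  move=> /(pieces_ok_mem ok) [p [[bdp _] xp H]].
  suff ap : a p by have := H a x ap xp; rewrite -UE; case: (x \in U).
  have := bdp x v xp; rewrite edge_sym => /(_ ux); rewrite in_setU => /orP[vp|//].
  by have := H predT v isT vp; rewrite filter_predT; have := cov v; rewrite vW addn1 => -[->].
have cW' : #|W :\ v| = w by move: cW; rewrite (cardsD1 v) vW => -[].
have [||m' m'le f] := IH (W :\ v) cW' (p' :: filter (predC a) L).
- split => //.
    split; first exact: setSD.
    move=> x y; rewrite !in_setD1 => /andP[_ xC] /andP[_ yC].
    by apply/existsP; exists t; rewrite !(subsetP Ct).
  apply: pieces_ok_filter ok _ => p ap [pW pc]; split => //.
  by rewrite subsetD1 pW.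
- move=> x; have := cov x; rewrite covS -UE.
  have -> : multiplicity (p' :: filter (predC a) L) x =
      ((x \in v |: U) + multiplicity (filter (predC a) L) x)%N.
    by rewrite /multiplicity big_cons.
  rewrite in_setU1 in_setD1.
  by have [->|_] := eqVneq x v; rewrite ?vW ?(negPf vU) //=; lia.
exists m' => //; apply: leq_trans m'le _.
rewrite {1}/cost big_cons -/(cost _) /=.
have -> : cost L = (cost (filter a L) + cost (filter (predC a) L))%N.
  by rewrite /cost !big_filter (bigID a).
rewrite cW cW'; nia.
Qed.

End Pieces.

(** After eliminating every vertex only the count remains as a state; one transition for each count
    at least [l] selects the solutions. *)
Lemma independent_set_formulation l k : treewidth_le G k ->
  exists2 m, (m <= 2 ^ k * (30 * n.+1 ^ 3))%N
    & has_extended_formulation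
        (solution_polytope (R := R) (independent_set_problem l) G) m.
Proof.
case=> D /bigmax_leqP Dk.
have Dk' (t : td_tree D) : (#|td_bag t| <= k.+1)%N by exact: Dk.
have [||m mle f] := @eliminate_all k D Dk' [set: G] [::].
- by [].
- by move=> x; rewrite /multiplicity big_nil in_setT.
pose T : finType := {j : 'I_n.+1 | (l <= j)%N}.
pose F (_ : unit) : set E := fun x =>
  exists X : {set G}, [/\ independent X, (l <= #|X|)%N & x = ind X].
have FE s x : F s x <-> exists (t : T) x1, [/\ tt = s,
    piece_set [set: G] ((restr set0 set0, val t) : states set0) x1 & x = x1 + 0].
  case: s; split.
    move=> [X [iX lX ->]].
    have jP : (l <= (inord #|X| : 'I_n.+1))%N by rewrite card_ord_inord.
    exists (Sub (inord #|X|) jP), (ind X); split => //; last by rewrite addr0.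
    by exists X; rewrite subsetT /= set0I set0U card_ord_inord.
  move=> [t [x1 [_ [X [_ iX cX ->]] ->]]]; exists X; rewrite addr0; split => //.
    by move: iX; rewrite /= set0I set0U.
  by rewrite cX; exact: (valP t).
have := transition1_formulation FE f => /state_formulation_extended H.
eexists; last first.
  rewrite (_ : solution_polytope _ _ = convex_hull (F tt)); first exact: H.
  congr convex_hull; apply/seteqP; split => x.
    by move=> [X /andP[iX lX] <-]; exists X.
  by move=> [X [iX lX ->]]; exists X => //; apply/andP.
have cT : (#|T| <= n.+1)%N.
  by rewrite card_sig; apply: leq_trans (max_card _) _; rewrite card_ord.
rewrite /states card_prod card_subs cards0 card_ord mul1n.
move: mle; rewrite /cost big_nil addn0 cardsT /step_cost expnS.
have := expn_gt0 2 k; move: (2 ^ k)%N #|T| cT => q c cT q0 mle.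
move: mle cT; move: #|G| => N mle cT.
have -> : (N.+1 ^ 3 = N.+1 * N.+1 ^ 2)%N by rewrite expnS.
have : (N.+1 <= N.+1 ^ 2)%N by rewrite -mulnn leq_pmulr.
move: (N.+1 ^ 2)%N mle => N2 mle hN2; nia.
Qed.

End DynamicProgram.

(** * Rectangle covers of unique disjointness *)

Section RectangleCover.
Local Open Scope classical_set_scope.
Variables (R : realType) (E : lmodType R) (S : set E) (m : nat).

(** A ratio test: [eps] is the minimum of 1 and of [c i / (|e i| + 1)] over the indices with
    [0 < c i]. *)
Lemma small_step (I : finType) (c e : I -> R) :
  exists2 eps : R, 0 < eps & forall i, 0 < c i -> eps * e i <= c i.
Proof.
suff [eps e0 H] : exists2 eps : R, 0 < eps &
    forall i, i \in enum I -> 0 < c i -> eps * e i <= c i.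
  by exists eps => // i; apply: H; rewrite mem_enum.
elim: (enum I) => [|j s [eps e0 H]]; first by exists 1.
pose d := c j / (`|e j| + 1).
have ej : 0 < `|e j| + 1 by rewrite ltr_wpDl.
have [cj|cj] := ltP 0 (c j); last first.
  by exists eps => // i; rewrite inE => /orP[/eqP ->|/H//]; rewrite ltNge cj.
have d0 : 0 < d by rewrite divr_gt0.
exists (Num.min eps d); first by rewrite lt_min e0.
move=> i; rewrite inE => /orP[/eqP ->|is_] ci.
  have [ge|lt] := leP 0 (e j); last first.
    apply: le_trans (ltW ci); rewrite pmulr_rle0 ?ltW //.
    by rewrite lt_min e0.
  apply: (@le_trans _ _ (d * e j)).
    by rewrite ler_wpM2r // ge_min lexx orbT.
  rewrite /d mulrAC ler_pdivrMr // ler_pM2l //.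
  by have := ler_norm (e j); lra.
have [ge|lt] := leP 0 (e i); last first.
  apply: le_trans (ltW ci); rewrite pmulr_rle0 ?ltW //.
  by rewrite lt_min e0.
apply: le_trans (H _ is_ ci).
by rewrite ler_wpM2r // ge_min lexx.
Qed.

(* Every face of the polyhedron is cut out by the constraints that are tight on it: a
   point [y] satisfying them lies in it, since a relative interior
   point [z] of the face can be moved slightly away from [y]. *)
Lemma extended_formulation_cover (I J : finType) (f : I -> E -> R)
    (x : J -> E) :
  has_extended_formulation S m ->
  (forall i y z (c : R), f i (y + c *: (y - z)) = f i y + c * (f i y - f i z)) ->
  (forall i y, S y -> 0 <= f i y) -> (forall i, exists2 y, S y & f i y = 0) ->
  (forall j, S (x j)) ->
  exists (P : 'I_m -> pred I) (Q : 'I_m -> pred J), forall i j,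
    0 < f i (x j) <-> exists r, P r i && Q r j.
Proof.
move=> [d [A [b [pi [_ SE]]]]] aff valid face xS.
have piS y : polyhedron A b y -> S (pi y) by move=> Qy; rewrite -SE; exists y.
have /choice [y yP] : forall j, exists y, polyhedron A b y /\ pi y = x j.
  by move=> j; have := xS j; rewrite -SE => -[y ? ?]; exists y.
pose tight r i := forall z, polyhedron A b z -> f i (pi z) = 0 ->
  (A *m z) r 0 = b r 0.
(* The rectangle of row [r] pairs the faces on which the row is tight with the points at which it is
   slack. *)
exists (fun r i => `[< tight r i >]), (fun r j => (A *m y j) r 0 < b r 0).
move=> i j; have [Qy py] := yP j; rewrite -py; split; last first.
  move=> [r /andP[/asboolP tr lt]]; rewrite lt_neqAle valid ?andbT; last exact: piS.
  by apply/eqP => f0; have := tr _ Qy (esym f0) => eqb; rewrite eqb ltxx in lt.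
move=> fpos; apply: contrapT => none.
have tight_y r : tight r i -> (A *m y j) r 0 = b r 0.
  move=> tr; apply/eqP; rewrite eq_le Qy /= leNgt; apply/negP => lt.
  by apply: none; exists r; rewrite lt andbT; apply/asboolP.
have affpi u v (c : R) :
    f i (pi (u + c *: (u - v))) = f i (pi u) + c * (f i (pi u) - f i (pi v)).
  by rewrite linearD linearZ linearB aff.
have affA u v (c : R) r : (A *m (u + c *: (u - v))) r 0 =
    (A *m u) r 0 + c * ((A *m u) r 0 - (A *m v) r 0).
  by rewrite mulmxDr -scalemxAr mulmxBr !mxE.
have [z [Qz fz zint]] : exists z, [/\ polyhedron A b z, f i (pi z) = 0
    & forall r, ~ tight r i -> (A *m z) r 0 < b r 0].
  suff [z [Qz fz H]] : exists z, [/\ polyhedron A b z, f i (pi z) = 0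
      & forall r, r \in enum 'I_m -> ~ tight r i -> (A *m z) r 0 < b r 0].
    by exists z; split => // r; apply: H; rewrite mem_enum.
  elim: (enum 'I_m) => [|r s [z [Qz fz H]]].
    have [u] := face i; rewrite -SE => -[z Qz <-] fz; by exists z.
  have [tr|ntr] := pselect (tight r i).
    by exists z; split => // r'; rewrite inE => /orP[/eqP -> //|]; exact: H.
  have [z' [Qz' fz' zr']] : exists z', [/\ polyhedron A b z', f i (pi z') = 0
      & (A *m z') r 0 < b r 0].
    apply: contrapT => no; apply: ntr => z' Qz' fz'; apply/eqP.
    rewrite eq_le Qz' /= leNgt; apply/negP => lt; apply: no; by exists z'.
  (* This is the midpoint of [z] and [z']; a row slack at either of them is slack here. *)
  exists (z + (- 2^-1) *: (z - z')); split.
  - by move=> r'; rewrite affA; have := Qz r'; have := Qz' r'; lra.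
  - by rewrite affpi fz fz'; lra.
  - move=> r'; rewrite inE => /orP[/eqP ->|r's] nt; rewrite affA.
      by have := Qz r; lra.
    by have := H _ r's nt; have := Qz' r'; lra.
have [eps e0 epsP] := small_step (fun r => b r 0 - (A *m z) r 0)
  (fun r => (A *m z) r 0 - (A *m y j) r 0).
have Qw : polyhedron A b (z + eps *: (z - y j)).
  move=> r; rewrite affA; have [tr|ntr] := pselect (tight r i).
    by rewrite tight_y // tr // subrr mulr0 addr0.
  by have := epsP r; rewrite subr_gt0 => /(_ (zint _ ntr)); lra.
(* Past [z], in the direction away from [y j], the affine function [f i] falls below its value 0 at
   [z]. *)
have := valid i _ (piS _ Qw); rewrite affpi fz add0r sub0r mulrN oppr_ge0.
by rewrite leNgt mulr_gt0.
Qed.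

End RectangleCover.

(** * Counting disjoint pairs in rectangles *)

Section UniqueDisjointness.
Local Open Scope nat_scope.

(** Nested pairs let the induction on [n] peel off one bit by projection. *)
Fixpoint cube (n : nat) : finType :=
  if n is n'.+1 then (bool * cube n')%type else unit.

Fixpoint bit n : cube n -> nat -> bool :=
  match n with
  | 0 => fun _ _ => false
  | n'.+1 => fun a i => if i is i'.+1 then @bit n' a.2 i' else a.1
  end.

Fixpoint overlap n : cube n -> cube n -> nat :=
  match n with
  | 0 => fun _ _ => 0
  | n'.+1 => fun a b => (a.1 && b.1) + @overlap n' a.2 b.2
  end.

Lemma overlapE n (a b : cube n) : overlap a b = \sum_(i < n) (bit a i && bit b i).
Proof.
elim: n a b => [|n IH] a b; first by rewrite big_ord0.
by rewrite big_ord_recl /= IH.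
Qed.

Lemma overlapC n (a b : cube n) : overlap a b = overlap b a.
Proof. by rewrite !overlapE; apply: eq_bigr => i _; rewrite andbC. Qed.

Fixpoint cube0 n : cube n :=
  match n return cube n with 0 => tt | n'.+1 => (false, cube0 n') end.

Lemma overlap0 n (b : cube n) : overlap (cube0 n) b = 0.
Proof. by elim: n b => //= n IH b; rewrite IH. Qed.

(** The singleton of the first true bit of [a]; it will show that the face belonging to [a] is
    nonempty. *)
Lemma cube_overlap1 n (a : cube n) : a != cube0 n -> exists b, overlap a b = 1.
Proof.
elim: n a => [[] //|n IH [[] a]] /=.
  by exists (true, cube0 n); rewrite /= overlapC overlap0.
by rewrite xpair_eqE eqxx => /IH [b <-]; exists (false, b).
Qed.

Lemma sum_cubeS n (F : cube n.+1 -> nat) :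
  \sum_a F a = \sum_(a : cube n) F (true, a) + \sum_(a : cube n) F (false, a).
Proof.
transitivity (\sum_(c : bool) \sum_(a : cube n) F (c, a)); last by rewrite big_bool.
by rewrite pair_bigA; apply: eq_bigr => -[].
Qed.

Definition disjoint_pairs n (A B : pred (cube n)) :=
  \sum_(a : cube n) \sum_(b : cube n) [&& A a, B b & overlap a b == 0].

Lemma disjoint_pairsS n (A B : pred (cube n.+1)) :
  disjoint_pairs A B = \sum_(a : cube n) \sum_(b : cube n)
   ([&& A (false, a), B (false, b) & overlap a b == 0] +
    [&& A (false, a), B (true, b) & overlap a b == 0] +
    [&& A (true, a), B (false, b) & overlap a b == 0]).
Proof.
rewrite /disjoint_pairs sum_cubeS -big_split; apply: eq_bigr => a _ /=.
rewrite !sum_cubeS /=.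
rewrite -!big_split /=; apply: eq_bigr => b _.
rewrite !add0n !andbF /=; lia.
Qed.

Lemma disjoint_pairs_total n : disjoint_pairs (@predT (cube n)) predT = 3 ^ n.
Proof.
elim: n => [|n IH].
  by rewrite /disjoint_pairs /= (big_pred1 tt) ?(big_pred1 tt) // => -[].
rewrite disjoint_pairsS expnS -IH /disjoint_pairs big_distrr /=.
apply: eq_bigr => a _; rewrite big_distrr /=; apply: eq_bigr => b _.
by case: (_ == _).
Qed.

(* The argument of Kaibel and Weltge: a disjoint pair of tails has at most two
   of its three extensions in the rectangle, and these are counted by two
   rectangles of tails with the same property. *)
Lemma disjoint_pairs_le n (A B : pred (cube n)) :
  (forall a b, A a -> B b -> overlap a b != 1) -> disjoint_pairs A B <= 2 ^ n.
Proof.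
elim: n A B => [|n IH] A B AB.
  rewrite /disjoint_pairs /= (big_pred1 tt) ?(big_pred1 tt) //; try by case.
  exact: leq_b1.
pose A' a := A (false, a) || A (true, a); pose B' b := B (false, b) || B (true, b).
have H1 : disjoint_pairs A' (fun b => B (false, b)) <= 2 ^ n.
  by apply: IH => a b /orP[] Aa Bb; have := AB _ _ Aa Bb.
have H2 : disjoint_pairs (fun a => A (false, a)) B' <= 2 ^ n.
  by apply: IH => a b Aa /orP[] Bb; have := AB _ _ Aa Bb.
rewrite expnS mul2n -addnn; apply: leq_trans (leq_add H1 H2).
rewrite disjoint_pairsS /disjoint_pairs -big_split /=; apply: leq_sum => a _.
rewrite -big_split /=; apply: leq_sum => b _; rewrite /A' /B'.
case m0: (overlap a b == 0); last by rewrite !andbF.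
rewrite !andbT; have := AB (true, a) (true, b).
rewrite /= (eqP m0) /=.
by case: (A (false, a)); case: (A (true, a)); case: (B (false, b));
   case: (B (true, b)) => // /(_ isT isT).
Qed.

Lemma unique_disjointness_cover n m (P Q : 'I_m -> pred (cube n)) :
  (forall a b, overlap a b = 0 -> exists r, P r a && Q r b) ->
  (forall r a b, P r a -> Q r b -> overlap a b != 1) ->
  3 ^ n <= m * 2 ^ n.
Proof.
move=> cov rect; rewrite -disjoint_pairs_total.
apply: (@leq_trans (\sum_(r < m) disjoint_pairs (P r) (Q r))).
  rewrite /disjoint_pairs [X in _ <= X]exchange_big /=.
  apply: leq_sum => a _.
  rewrite [X in _ <= X]exchange_big /=; apply: leq_sum => b _.
  case: eqP => // /cov [r /andP[Pr Qr]].
  by rewrite (bigD1 r) //= Pr Qr.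
have -> : m * 2 ^ n = \sum_(r < m) 2 ^ n by rewrite sum_nat_const card_ord.
apply: leq_sum => r _.
by apply: disjoint_pairs_le => a b; exact: rect.
Qed.

End UniqueDisjointness.

(** * The correlation graph *)

Section Star.
Variable L : finType.

Definition star_edge : rel (option L) := fun s t => (s == None) (+) (t == None).

Lemma star_edge_sym : symmetric star_edge.
Proof. by move=> s t; rewrite /star_edge addbC. Qed.

Lemma star_edge_irrefl : irreflexive star_edge.
Proof. by move=> s; rewrite /star_edge addbb. Qed.

Definition star := SGraph star_edge_sym star_edge_irrefl.

(** Of any two adjacent nodes exactly one is the centre [None], so a cycle of three or more nodes
    would visit it twice. *)
Lemma star_tree : is_tree star.
Proof.
split.
- by apply/card_gt0P; exists None.
- have toN (s : star) : connect (@edge star) s None.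
    by case: s => [s|]; [apply: connect1 | exact: connect0].
  move=> s t; apply: connect_trans (toN s) _.
  by rewrite (sym_connect_sym star_edge_sym); exact: toN.
case=> [|x [|y [|z c]]] //= /andP[/=].
rewrite /star_edge rcons_path /=.
case: x => [x|]; case: y => [y|]; case: z => [z|] //=; rewrite ?andbF //.
case/andP => _ ls; rewrite !inE !negb_or => /and3P[_ /andP[_ Nc] _].
by move: ls; case: c Nc => //= u c Nc; case lE: (last u c) => [l|] //;
   rewrite -lE mem_last in Nc.
Qed.

End Star.

Section CorrelationGraph.
Variables (N l : nat).

(* The vertex [(i, c)] says that bit [i] is [c], and [(i, j, (c, d))] that the
   bits [i], [j] are [c], [d]; the last [l] vertices are isolated. *)
Definition corr_vertex : finType :=
  ('I_N * bool + 'I_N * 'I_N * (bool * bool) + 'I_l)%type.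
Definition corr_group : finType := ('I_N + 'I_N * 'I_N + 'I_l)%type.

Definition group_of (v : corr_vertex) : corr_group :=
  match v with
  | inl (inl p) => inl (inl p.1)
  | inl (inr q) => inl (inr q.1)
  | inr e => inr e
  end.

Definition is_var (v : corr_vertex) : bool := if v is inl (inl _) then true else false.

Definition conflict (u v : corr_vertex) : bool :=
  match u, v with
  | inl (inl p), inl (inr q) =>
      ((p.1 == q.1.1) && (p.2 != q.2.1)) || ((p.1 == q.1.2) && (p.2 != q.2.2))
  | _, _ => false
  end.

(** Groups are cliques, so an independent set picks at most one value per bit and per pair; conflict
    edges make the pairs agree with the bits. *)
Definition corr_edge : rel corr_vertex := fun u v =>
  [|| (u != v) && (group_of u == group_of v), conflict u v | conflict v u].

Lemma corr_edge_sym : symmetric corr_edge.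
Proof.
move=> u v; rewrite /corr_edge eq_sym [group_of u == _]eq_sym.
by congr orb; exact: orbC.
Qed.

Lemma corr_edge_irrefl : irreflexive corr_edge.
Proof. by move=> v; rewrite /corr_edge eqxx /=; case: v => [[]|]. Qed.

Definition corr_graph := SGraph corr_edge_sym corr_edge_irrefl.

Lemma card_corr_graph : #|corr_graph| = (2 * N + 4 * N ^ 2 + l)%N.
Proof. rewrite !card_sum !card_prod !card_bool !card_ord -mulnn; lia. Qed.

Lemma conflict_var u v : conflict u v -> is_var u.
Proof. by case: u => [[]|]. Qed.

(** The centre of the star holds the [2 * N] bit vertices; each leaf adds one group, of at most 4
    vertices. *)
Definition corr_bag (t : option corr_group) : {set corr_vertex} :=
  [set v | is_var v || (t == Some (group_of v))].

Lemma card_corr_bag t : (#|corr_bag t| <= (2 * N + 3).+1)%N.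
Proof.
pose var := [set (inl (inl p) : corr_vertex) | p in [set: 'I_N * bool]].
have cvar : (#|var| <= 2 * N)%N.
  by apply: leq_trans (leq_imset_card _ _) _; rewrite cardsT card_prod card_bool card_ord mulnC.
pose grp := if t is Some g then [set v : corr_vertex | group_of v == g] else finset.set0.
have cgrp : (#|grp| <= 4)%N.
  rewrite /grp; case: t @grp => [g _|_]; last by rewrite cards0.
  pose h (c : bool * bool) : corr_vertex := match g with
    | inl (inl i) => inl (inl (i, c.1))
    | inl (inr ij) => inl (inr (ij, c))
    | inr e => inr e
    end.
  have <- : #|[set: bool * bool]| = 4%N by rewrite cardsT card_prod card_bool.
  apply: leq_trans (leq_imset_card h _); apply: subset_leq_card.
  apply/fintype.subsetP => v; rewrite finset.inE => /eqP gv; apply/imsetP.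
  rewrite /h -gv; case: v {gv} => [[[i c]|[ij c]]|e] /=.
  - by exists (c, c); rewrite ?finset.in_setT.
  - by exists c; rewrite ?finset.in_setT.
  - by exists (true, true); rewrite ?finset.in_setT.
have -> : (2 * N + 3).+1 = (2 * N + 4)%N by lia.
apply: leq_trans (leq_add cvar cgrp); apply: leq_trans (leq_card_setU _ _).
apply: subset_leq_card; apply/fintype.subsetP => v; rewrite !finset.inE => /orP[|/eqP tv].
  by case: v => [[p|]|] // _; apply/orP; left; apply/imsetP; exists p.
by rewrite /grp tv finset.inE eqxx orbT.
Qed.

Lemma corr_treewidth : treewidth_le corr_graph (2 * N + 3).
Proof.
have tv (v : corr_graph) : exists t : star corr_group, v \in corr_bag t.
  by exists (Some (group_of v)); rewrite finset.inE eqxx orbT.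
have te (u v : corr_graph) : edge u v ->
    exists t : star corr_group, (u \in corr_bag t) && (v \in corr_bag t).
  case/or3P => [/andP[_ /eqP uv]|/conflict_var uv|/conflict_var uv].
  - by exists (Some (group_of v)); rewrite !finset.inE uv eqxx !orbT.
  - by exists (Some (group_of v)); rewrite !finset.inE uv eqxx !orbT.
  - by exists (Some (group_of u)); rewrite !finset.inE uv eqxx !orbT.
have tc (v : corr_graph) (s t : star corr_group) :
    v \in corr_bag s -> v \in corr_bag t ->
    connect [rel a b | [&& @edge (star corr_group) a b, v \in corr_bag a & v \in corr_bag b]] s t.
  move=> vs vt; have [vv|nv] := boolP (is_var v); last first.
    move: vs vt; rewrite !finset.inE (negPf nv) /= => /eqP -> /eqP ->; exact: connect0.
  have all_t r : v \in corr_bag r by rewrite finset.inE vv.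
  have [_ con _] := star_tree corr_group.
  apply: connect_sub (con s t) => a b ab.
  by apply: connect1; apply/and3P; split.
exists (TreeDecomposition (star_tree corr_group) tv te tc).
by apply/bigmax_leqP => t _; exact: card_corr_bag.
Qed.

(** The maximum independent set encoding [b]. It contains all [l] isolated vertices, hence meets the
    size condition. *)
Definition corr_point (b : nat -> bool) : {set corr_graph} :=
  [set v : corr_vertex | match v with
    | inl (inl p) => p.2 == b p.1
    | inl (inr q) => (q.2.1 == b q.1.1) && (q.2.2 == b q.1.2)
    | inr _ => true end].

Lemma corr_point_independent b : independent (corr_point b).
Proof.
apply/independentP => u v; rewrite !finset.inE.
case: u => [[[i c]|[[i j] [c d]]]|e]; case: v => [[[i' c']|[[i' j'] [c' d']]]|e'] //=;
  rewrite /corr_edge /=; rewrite ?orbF.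
- move=> /eqP -> /eqP ->; apply/negP => /andP[/eqP H /eqP[ii]]; apply: H.
  by rewrite ii.
- move=> /eqP -> /andP[/eqP -> /eqP ->]; apply/negP => /orP[]/andP[/eqP ->]; by rewrite eqxx.
- move=> /andP[/eqP -> /eqP ->] /eqP ->; apply/negP => /orP[]/andP[/eqP ->]; by rewrite eqxx.
- move=> /andP[/eqP -> /eqP ->] /andP[/eqP -> /eqP ->].
  by apply/negP => /andP[/eqP H /eqP[ii jj]]; apply: H; rewrite ii jj.
- by move=> _ _; apply/negP => /andP[/eqP H /eqP[ee]]; apply: H; rewrite ee.
Qed.

Lemma group_of_inj (X : {set corr_graph}) :
  independent X -> {in X &, injective group_of}.
Proof.
move=> /independentP iX u v uX vX guv; apply/eqP; apply: contraNT (iX u v uX vX) => uv.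
by rewrite /edge /= /corr_edge uv guv eqxx.
Qed.

Lemma card_group : #|corr_group| = (N + N ^ 2 + l)%N.
Proof. by rewrite !card_sum card_prod !card_ord mulnn. Qed.

Lemma corr_card_le (X : {set corr_graph}) : independent X -> (#|X| <= #|corr_group|)%N.
Proof. by move=> /group_of_inj inj; rewrite -(card_in_imset inj); exact: max_card. Qed.

Lemma corr_point_card b : #|corr_point b| = #|corr_group|.
Proof.
rewrite -(card_in_imset (group_of_inj (corr_point_independent b))).
apply: eq_card => g; rewrite finset.inE; apply/imsetP.
case: g => [[i|[i j]]|e].
- by exists (inl (inl (i, b i))) => //; rewrite finset.inE.
- by exists (inl (inr ((i, j), (b i, b j)))) => //; rewrite finset.inE /= !eqxx.
- by exists (inr e) => //; rewrite finset.inE.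
Qed.

(** Such a set meets every group exactly once. Its bit vertices define [b], and the conflict edges
    then determine its pair vertices. *)
Lemma corr_max (X : {set corr_graph}) : independent X -> #|X| = #|corr_group| ->
  exists b : nat -> bool, X = corr_point b.
Proof.
move=> iX cX; have inj := group_of_inj iX.
have surj g : exists2 v, v \in X & group_of v = g.
  have /eqP : [set group_of v | v in X] == [set: corr_group].
    by rewrite finset.eqEcard finset.subsetT (card_in_imset inj) cX cardsT leqnn.
  move=> /setP/(_ g); rewrite finset.in_setT => /imsetP [v vX ->]; by exists v.
pose b (i : nat) : bool := [exists i' : 'I_N, (i' == i :> nat) && (inl (inl (i', true)) \in X)].
have bE (i : 'I_N) : b i = (inl (inl (i, true)) \in X).
  apply/existsP/idP => [[i' /andP[/eqP ii]]|iX']; last by exists i; rewrite eqxx.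
  by rewrite (val_inj ii).
have varX (i : 'I_N) c : inl (inl (i, c)) \in X -> c = b i.
  rewrite bE; case: c => [->//|f]; apply/esym/negP => t.
  by have := inj _ _ t f erefl.
have bX (i : 'I_N) : inl (inl (i, b i)) \in X.
  have [[[[i' c]|]|] // vX [ii]] := surj (inl (inl i)).
  by rewrite /= in ii; subst i'; rewrite -(varX _ _ vX).
exists b; apply/esym/eqP; rewrite finset.eqEcard cX corr_point_card leqnn andbT.
apply/fintype.subsetP => v vb.
have [u uX gu] := surj (group_of v).
suff -> : v = u by [].
have ub : u \in corr_point b; last first.
  exact: group_of_inj (corr_point_independent b) _ _ vb ub (esym gu).
rewrite finset.inE; case: u uX {gu} => [[[i c]|[[i j] [c d]]]|e] uX //=.
  by rewrite (varX _ _ uX).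
move/independentP: iX => iX.
have := iX _ _ (bX i) uX; have := iX _ _ (bX j) uX.
rewrite /edge /= /corr_edge /= !eqxx /= !orbF !negb_or !negbK.
by move=> /andP[_ /eqP ->] /andP[/eqP -> _]; rewrite !eqxx.
Qed.

End CorrelationGraph.

Lemma sum_pair (V : nmodType) (I J : finType) (F : I * J -> V) :
  \sum_p F p = \sum_i \sum_j F (i, j).
Proof. by rewrite pair_bigA; apply: eq_bigr => -[]. Qed.

(** * The unique disjointness pattern in the independent set polytope *)

Section LowerBound.
Variables (R : realType) (N l : nat).
Notation G := (corr_graph N l).
Notation E := {ffun G -> R^o}.
Notation ind := (indicator_vector R).

Definition var_coord (y : E) (i : 'I_N) : R := y (inl (inl (i, true))).
Definition pair_coord (y : E) (i j : 'I_N) : R := y (inl (inr ((i, j), (true, true)))).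

(** Coefficients of the expanded square [(1 - sum_i a_i b_i)^2], with the products [b_i b_j]
    replaced by pair coordinates. *)
Definition corr_coef (a : cube N) (v : corr_vertex N l) : R :=
  match v with
  | inl (inl p) => - 2 * (bit a p.1 && p.2)%:R
  | inl (inr q) => [&& bit a q.1.1, bit a q.1.2, q.2.1 & q.2.2]%:R
  | inr _ => 0
  end.

(* On the maximum independent set of [b] this is [(1 - overlap a b) ^+ 2]; the
   last term is a penalty that makes it nonnegative on all independent sets. *)
Definition corr_form (a : cube N) (y : E) : R :=
  1 + \sum_(v : G) corr_coef a v * y v
  + (2 * N)%:R * (#|corr_group N l|%:R - \sum_(v : G) y v).

Lemma corr_coef_sum a (y : E) : \sum_(v : G) corr_coef a v * y v =
  - 2 * (\sum_(i < N) (bit a i)%:R * var_coord y i)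
  + \sum_(i < N) \sum_(j < N) (bit a i && bit a j)%:R * pair_coord y i j.
Proof.
rewrite !big_sumType /= [X in _ + X]big1 ?addr0 => [|i _]; last by rewrite mul0r.
congr (_ + _).
  rewrite sum_pair mulr_sumr; apply: eq_bigr => i _; rewrite big_bool /=.
  by rewrite andbT andbF mulr0 mul0r addr0 mulrA.
rewrite sum_pair sum_pair; apply: eq_bigr => i _; apply: eq_bigr => j _.
rewrite sum_pair !big_bool /= !andbF !andbT !mul0r !addr0.
by [].
Qed.

Lemma corr_form_affine a (y z : E) (c : R) :
  corr_form a (y + c *: (y - z)) =
  corr_form a y + c * (corr_form a y - corr_form a z).
Proof.
have lin (h : G -> R) : \sum_(v : G) h v * (y + c *: (y - z)) v =
   \sum_(v : G) h v * y v + c * (\sum_(v : G) h v * y v - \sum_(v : G) h v * z v).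
  rewrite -sumrB mulr_sumr -big_split /=; apply: eq_bigr => v _.
  rewrite !ffunE /GRing.scale /=; ring.
have lin1 : \sum_(v : G) (y + c *: (y - z)) v =
   \sum_(v : G) y v + c * (\sum_(v : G) y v - \sum_(v : G) z v).
  have e1 (h : E) : \sum_(v : G) 1 * h v = \sum_(v : G) h v.
    by apply: eq_bigr => v _; rewrite mul1r.
  by have := lin (fun=> 1); rewrite /= !e1.
rewrite /corr_form lin lin1; ring.
Qed.

Lemma corr_form_convex a m (w : 'I_m -> R) (y : 'I_m -> E) : \sum_i w i = 1 ->
  corr_form a (\sum_i w i *: y i) = \sum_i w i * corr_form a (y i).
Proof.
move=> sw.
have lin (h : G -> R) : \sum_(v : G) h v * (\sum_i w i *: y i) v =
   \sum_i w i * \sum_(v : G) h v * y i v.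
  under [RHS]eq_bigr => i _ do rewrite mulr_sumr.
  rewrite exchange_big /=; apply: eq_bigr => v _; rewrite sum_ffunE mulr_sumr.
  by apply: eq_bigr => i _; rewrite ffunE /GRing.scale /=; ring.
have lin1 : \sum_(v : G) (\sum_i w i *: y i) v = \sum_i w i * \sum_(v : G) y i v.
  have e1 (h : E) : \sum_(v : G) 1 * h v = \sum_(v : G) h v.
    by apply: eq_bigr => v _; rewrite mul1r.
  have := lin (fun=> 1); rewrite /= e1 => ->.
  by apply: eq_bigr => i _; rewrite e1.
rewrite /corr_form lin lin1.
under [RHS]eq_bigr => i _ do rewrite mulrDr mulrDr mulr1 mulrCA mulrBr.
by rewrite !big_split /= sw -mulr_sumr big_split /= -mulr_suml sw mul1r sumrN.
Qed.

Lemma corr_form_point a (b : nat -> bool) :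
  corr_form a (ind (corr_point N l b)) =
  (1 - (\sum_(i < N) (bit a i && b i))%:R) ^+ 2.
Proof.
rewrite /corr_form corr_coef_sum.
have -> : \sum_(v : G) ind (corr_point N l b) v = #|corr_group N l|%:R.
  rewrite -(corr_point_card _ _ b) -sum1_card natr_sum [RHS]big_mkcond /=.
  by apply: eq_bigr => v _; rewrite ffunE; case: (v \in _).
rewrite subrr mulr0 addr0 natr_sum.
have -> : \sum_(i < N) (bit a i)%:R * var_coord (ind (corr_point N l b)) i =
    \sum_(i < N) (bit a i && b i)%:R :> R.
  by apply: eq_bigr => i _; rewrite /var_coord ffunE finset.inE /= -natrM mulnb; case: (b i).
have -> : \sum_(i < N) \sum_(j < N) (bit a i && bit a j)%:R *
      pair_coord (ind (corr_point N l b)) i j =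
    (\sum_(i < N) (bit a i && b i)%:R) ^+ 2 :> R.
  rewrite expr2 mulr_suml; apply: eq_bigr => i _; rewrite mulr_sumr.
  apply: eq_bigr => j _; rewrite /pair_coord ffunE finset.inE /= -!natrM !mulnb.
  by case: (bit a i); case: (bit a j); case: (b i); case: (b j).
ring.
Qed.

(** On maximum sets the form is a square. Any other set misses a group, and the penalty of at least
    [2 * N] outweighs the negative terms, which are at least [- 2 * N]. *)
Lemma corr_form_independent a (X : {set G}) :
  independent X -> 0 <= corr_form a (ind X).
Proof.
move=> iX; have := corr_card_le iX; rewrite leq_eqVlt => /orP[/eqP cX|cX].
  by have [b ->] := corr_max iX cX; rewrite corr_form_point sqr_ge0.
rewrite /corr_form corr_coef_sum.
have -> : \sum_(v : G) ind X v = #|X|%:R.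
  rewrite -sum1_card natr_sum [RHS]big_mkcond /=.
  by apply: eq_bigr => v _; rewrite ffunE; case: (v \in _).
have s1 : \sum_(i < N) (bit a i)%:R * var_coord (ind X) i <= N%:R.
  rewrite -[N in X in _ <= X]card_ord -sum1_card natr_sum; apply: ler_sum => i _.
  by rewrite /var_coord ffunE -natrM mulnb ler_nat leq_b1.
have s2 : 0 <= \sum_(i < N) \sum_(j < N) (bit a i && bit a j)%:R * pair_coord (ind X) i j.
  apply: sumr_ge0 => i _; apply: sumr_ge0 => j _.
  by rewrite /pair_coord ffunE -natrM.
have s3 : (2 * N)%:R <= (2 * N)%:R * (#|corr_group N l|%:R - #|X|%:R) :> R.
  rewrite -natrB ?(ltnW cX) // -natrM ler_nat leq_pmulr // subn_gt0.
  exact: cX.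
by move: s1 s2 s3; rewrite natrM; lra.
Qed.

Lemma corr_lower_bound m :
  has_extended_formulation
    (solution_polytope (R := R) (independent_set_problem l) G) m ->
  (3 ^ N <= m.+1 * 2 ^ N)%N.
Proof.
move=> ef.
pose pt (b : cube N) : E := ind (corr_point N l (bit b)).
have ptS b : solution_polytope (independent_set_problem l) G (pt b).
  apply/weighted_hull1/weighted_hull_point; exists (corr_point N l (bit b)) => //=.
  rewrite /independent_set_problem corr_point_independent corr_point_card card_group.
  exact: leq_addl.
have valid a y : solution_polytope (independent_set_problem l) G y -> 0 <= corr_form a y.
  move=> [k [w [x [w0 sw xS ->]]]]; rewrite corr_form_convex //.
  apply: sumr_ge0 => i _; apply: mulr_ge0 => //.
  by have [X /andP[iX _] <-] := xS i; exact: corr_form_independent.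
have formE a b : corr_form a (pt b) = (1 - (overlap a b)%:R) ^+ 2.
  by rewrite corr_form_point overlapE.
pose I : finType := {a : cube N | a != cube0 N}.
have [||||P [Q PQ]] := extended_formulation_cover (f := fun a : I => corr_form (val a))
    (x := pt) ef.
- by move=> a y z c; exact: corr_form_affine.
- by move=> a y; exact: valid.
- move=> a; have [b ab] := cube_overlap1 (valP a).
  by exists (pt b) => //; rewrite formE ab subrr expr0n.
- by [].
(* The form of [cube0] vanishes nowhere on the polytope and cuts out no face; the extra rectangle
   [ord0] covers its whole row. *)
pose P' (r : 'I_m.+1) (a : cube N) := if unlift ord0 r is Some r' then
  (if insub a is Some a' then P r' a' else false) else a == cube0 N.
pose Q' (r : 'I_m.+1) (b : cube N) := if unlift ord0 r is Some r' then Q r' b else true.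
apply: (@unique_disjointness_cover _ _ P' Q') => [a b ab|r a b].
  have [a0|a0] := eqVneq a (cube0 N).
    by exists ord0; rewrite /P' /Q' unlift_none a0 eqxx.
  have /PQ [r rP] : 0 < corr_form (val (Sub a a0 : I)) (pt b).
    by rewrite formE SubK ab subr0 expr1n.
  by exists (lift ord0 r); rewrite /P' /Q' liftK (insubT (fun a => a != cube0 N) a0).
rewrite /P' /Q'; case: unliftP => [r' _|_]; last by move=> /eqP -> _; rewrite overlap0.
case: insubP => // a' _ <- Pa Qb; apply/eqP => ab.
have /PQ : exists r, P r a' && Q r b by exists r'; rewrite Pa.
by rewrite formE ab subrr expr0n ltxx.
Qed.

End LowerBound.

(** * Growth estimates and conclusion *)

Lemma two_mul_64_lt_81 M : (3 <= M)%N -> (2 * 64 ^ M < 81 ^ M)%N.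
Proof.
case: M => [|[|[|M]]] // _; elim: M => [|M IH]; first by rewrite !expnS !expn0; lia.
move: IH; rewrite ![in X in _ -> X](expnS _ M.+3); lia.
Qed.

Lemma exp2_beats_power (M0 s d : nat) :
  exists M, [/\ (M0 <= M)%N, (3 <= M)%N & (2 ^ s * M ^ d <= 2 ^ M)%N].
Proof.
(* For a power of two the claim compares exponents: [s + 2 * i * d] is at most [(i + 1)^2], hence at
   most [2 ^ (2 * i)]. *)
pose i := (s + 2 * d + M0 + 2)%N; exists (2 ^ (2 * i))%N.
have h : (i.+1 ^ 2 <= 2 ^ (2 * i))%N.
  by rewrite mulnC expnM leq_exp2r // ltn_expl.
have h' : (i.+1 <= i.+1 ^ 2)%N by rewrite -mulnn leq_pmulr.
split; try by rewrite (leq_trans _ (leq_trans h' h)) // /i; lia.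
rewrite -expnM -expnD leq_exp2l //; apply: leq_trans h.
by rewrite -mulnn /i; nia.
Qed.

Theorem theorem6p3 (R : realType) :
  (exists p : nat -> R, polynomially_bounded p /\
     forall l : nat,
       has_extension_complexity (independent_set_problem l)
         (fun k n => 2 ^+ k * p n))
  /\
  (ETH R ->
     forall (l : nat) (g p : nat -> R), sublinear g -> polynomially_bounded p ->
       no_extended_formulation (independent_set_problem l)
         (fun k n => 2 `^ (g k) * p n)).
Proof.
split.
  exists (fun n => (30 * n.+1 ^ 3)%:R); split.
    (* For [n >= 1], [n + 1 <= 2 * n] gives the constant [240 = 30 * 2 ^ 3]. *)
    exists 3%N; apply/eqO_exP; exists 240%:R; first by rewrite ltr0n.
    exists 1%N => // n /= n1; rewrite !ger0_norm ?exprn_ge0 //.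
    rewrite -natrX -natrM ler_nat.
    rewrite (_ : 240 = 30 * 2 ^ 3)%N // -mulnA -expnMn leq_mul2l /= leq_exp2r //; lia.
  move=> l k G tw.
  have [m mle ef] := independent_set_formulation R l tw.
  by exists m; split => //; rewrite -natrX -natrM ler_nat.
move=> _ l g p /eqoP gsub [c /eqO_exP [C C0 [n0 _ pC]]].
(* Below [k = 8 * M + 3 <= 11 * M], so the factor [1/11] yields [g k <= M]. *)
have [k0 _ gk] := gsub (11%:R^-1) ltac:(by rewrite invr_gt0).
pose s := (Num.truncn C).+1.
have Cs : C <= 2 ^+ s.
  have h := truncnS_gt C; apply: le_trans (ltW h) _.
  by rewrite -natrX ler_nat ltnW // ltn_expl.
(* The graph will have [n <= (72 + l) * M ^ 2] vertices, so
   [C * n ^ c <= 2 ^ (s + D) * M ^ (2 * c)], which the choice of [M] bounds by [2 ^ M]. *)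
pose D := ((72 + l) ^ c)%N.
have [M [M0 M3 MP]] := exp2_beats_power (n0 + k0) (s + D) (2 * c).
(* With this [N] the cover bound reads [81 ^ M <= m.+1 * 16 ^ M], while [m <= 4 ^ M] would bound the
   right side by [2 * 64 ^ M]. *)
pose N := (4 * M)%N; pose k := (2 * N + 3)%N.
exists k, (corr_graph N l); split; first exact: corr_treewidth.
move=> m mle ef.
have lb := corr_lower_bound ef.
set n := #|corr_graph N l| in mle.
have nE : n = (8 * M + 64 * M ^ 2 + l)%N by rewrite /n card_corr_graph /N -!mulnn; lia.
have nle : (n <= (72 + l) * M ^ 2)%N by rewrite nE -mulnn; nia.
have gle : g k <= M%:R.
  have := gk k; rewrite /= => /(_ ltac:(rewrite /k /N; lia)).
  move=> h; apply: le_trans (ler_norm _) _; apply: le_trans h _.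
  rewrite ger0_norm // mulrC ler_pdivrMr // -natrM ler_nat /k /N; lia.
have ple : p n <= 2 ^+ M.
  have := pC n; rewrite /= => /(_ ltac:(rewrite nE; lia)).
  move=> h; apply: le_trans (ler_norm _) _; apply: le_trans h _.
  rewrite ger0_norm ?exprn_ge0 //.
  apply: (@le_trans _ _ ((2 ^ s * (2 ^ D * M ^ (2 * c)))%:R)).
    rewrite natrM natrX; apply: ler_pM; [exact: ltW|exact: exprn_ge0| |].
      exact: Cs.
    rewrite -natrX ler_nat; apply: (@leq_trans (((72 + l) * M ^ 2) ^ c)).
      by case: (c) => // c'; rewrite leq_exp2r.
    rewrite expnMn -expnM leq_mul2r; apply/orP; right.
    by apply: ltnW; exact: ltn_expl.
  by rewrite mulnA -expnD -natrX ler_nat.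
have : m%:R <= (4 ^ M)%:R :> R.
  apply: le_trans mle _.
  rewrite (_ : 4 = 2 * 2)%N // expnMn natrM natrX.
  apply: (@le_trans _ _ (2 `^ g k * 2 ^+ M)).
    by rewrite ler_wpM2l // powR_ge0.
  by rewrite ler_wpM2r ?exprn_ge0 // -powR_mulrn // ler_powR // ler1n.
rewrite ler_nat => m4.
have := two_mul_64_lt_81 M3; rewrite ltnNge => /negP; apply.
have e81 : (3 ^ N = 81 ^ M)%N by rewrite /N expnM.
have e16 : (2 ^ N = 16 ^ M)%N by rewrite /N expnM.
move: lb; rewrite e81 e16 => lb; apply: leq_trans lb _.
rewrite (_ : 64 = 4 * 16)%N // expnMn mulnA leq_mul2r; apply/orP; right.
have : (0 < 4 ^ M)%N by rewrite expn_gt0.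
lia.
Qed.
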